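(* Let $M$ be a smooth manifold and let $B\in\Gamma(\mathrm T^*M\otimes \mathrm T^*M)$ be a non-degenerate 2-covariant tensor field such that its skew-symmetric part $\omega$ has constant rank. Then there exists a non-degenerate 2-covariant tensor field $B'\in\Gamma(\mathrm T^*M\otimes \mathrm T^*M)$, with skew-symmetric part $\omega'$ and symmetric part $S'$, satisfying $\mathrm TM=\operatorname{Ker}\omega'\oplus\operatorname{Ker}S'$ and $$(\mathsf\Lambda^2\widehat B^{-1})(\omega)=(\mathsf\Lambda^2\widehat{B'}^{-1})(\omega').$$
   Context: Manifolds are smooth and paracompact, and all objects are smooth. For a 2-covariant tensor field $T$, $\widehat T\colon \mathrm TM\to \mathrm T^*M$, $\widehat T(v)=T(v,\cdot)$; $\operatorname{Ker}T$ means $\operatorname{Ker}\widehat T$; $T$ is non-degenerate if $\widehat T$ is an isomorphism. The skew-symmetric and symmetric parts of $T$ are $\frac12(T(u,v)-T(v,u))$ and $\frac12(T(u,v)+T(v,u))$. The bivector field $(\mathsf\Lambda^2\widehat B^{-1})(\omega)$ is given by $(\alpha,\beta)\mapsto\omega(\widehat B^{-1}(\alpha),\widehat B^{-1}(\beta))$, and similarly for $B',\omega'$. *)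

(* Defs.v *)
From HB Require Import structures.
From mathcomp Require Import all_boot all_order all_algebra.
From mathcomp Require Import all_classical all_reals all_analysis.
Import Order.TTheory GRing.Theory Num.Theory.
Import numFieldNormedType.Exports.

Set Implicit Arguments.
Unset Strict Implicit.
Unset Printing Implicit Defensive.

Local Open Scope classical_set_scope.
Local Open Scope ring_scope.

(* For U open in a finite-dimensional space V, this is the usual class
   C^k(U, W): differentiability at each stage, plus continuity of the iterated
   directional derivatives of order k. *)
Fixpoint Ck_on (R : realType) (V W : normedModType R) (k : nat)
    (U : set V) (f : V -> W) : Prop :=
  match k with
  | 0 => forall x, U x -> {for x, continuous f}
  | k'.+1 => (forall x, U x -> differentiable f x) /\
             (forall v, Ck_on k' U (fun x => 'D_v f x))
  end.

Definition smooth_on (R : realType) (V W : normedModType R)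
    (U : set V) (f : V -> W) : Prop := forall k, Ck_on k U f.

Definition open_cover (T : topologicalType) (C : set (set T)) : Prop :=
  C `<=` open /\ \bigcup_(A in C) A = [set: T].

Definition locally_finite (T : topologicalType) (C : set (set T)) : Prop :=
  forall x : T, exists2 N, nbhs x N &
    finite_set [set A | C A /\ A `&` N !=set0].

Definition paracompact (T : topologicalType) : Prop :=
  forall C : set (set T), open_cover C ->
    exists C' : set (set T),
      [/\ open_cover C', locally_finite C' &
          forall A, C' A -> exists2 A', C A' & A `<=` A'].

(* [chart_map i] is only meaningful on [chart_dom i], and [chart_inv i] on the
   open set [chart_map i @` chart_dom i]; the values elsewhere are junk.  Any
   smooth atlas is accepted: it determines the smooth structure (its maximal atlas). *)
Record smoothManifold (R : realType) (n : nat) := SmoothManifold {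
  space :> topologicalType ;
  space_hausdorff : hausdorff_space space ;
  space_paracompact : paracompact space ;
  chart : Type ;
  chart_dom : chart -> set space ;
  chart_map : chart -> space -> 'rV[R]_n ;
  chart_inv : chart -> 'rV[R]_n -> space ;
  chart_dom_open : forall i, open (chart_dom i) ;
  chart_image_open : forall i, open (chart_map i @` chart_dom i) ;
  chart_mapK : forall i p, chart_dom i p -> chart_inv i (chart_map i p) = p ;
  chart_map_continuous : forall i p, chart_dom i p ->
    {for p, continuous (chart_map i)} ;
  chart_inv_continuous : forall i x, (chart_map i @` chart_dom i) x ->
    {for x, continuous (chart_inv i)} ;
  chart_dom_cover : forall p, exists i, chart_dom i p ;
  transition_smooth : forall i j,
    smooth_on (chart_map i @` (chart_dom i `&` chart_dom j))
      (chart_map j \o chart_inv i) }.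

Arguments chart_dom {R n s}.
Arguments chart_map {R n s}.
Arguments chart_inv {R n s}.
Arguments chart_dom_cover {R n s}.

Lemma diff_comp_near (R : realType) (U V W : normedModType R)
    (f : U -> V) (g : V -> W) (h : U -> W) (x : U) (y : V) (w : U) :
  f x = y -> differentiable f x -> differentiable g y -> differentiable h x ->
  (\near x, g (f x) = h x) -> 'd g y ('d f x w) = 'd h x w.
Proof.
move=> <- df dg dh fgh; have dgf := differentiable_comp df dg.
transitivity ('d (g \o f) x w); first by rewrite (diff_comp df dg).
rewrite -(deriveE w dgf) -(deriveE w dh).
by apply: (@near_eq_derive R U W (g \o f) h x w fgh).
Qed.

Section TangentSpace.
Context {R : realType} {n : nat} (M : smoothManifold R n).
Implicit Types (p : M) (i j k : chart M).

Definition transition i j : 'rV[R]_n -> 'rV[R]_n := chart_map j \o chart_inv i.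

Lemma transition_diff p i j : chart_dom i p -> chart_dom j p ->
  differentiable (transition i j) (chart_map i p).
Proof.
by move=> ip jp; have [+ _] := transition_smooth i j 1; apply; exists p.
Qed.

Lemma transition_chart_map p i j : chart_dom i p ->
  transition i j (chart_map i p) = chart_map j p.
Proof. by move=> ip; rewrite /transition /= chart_mapK. Qed.

Lemma transition_cocycle p i j k (w : 'rV[R]_n) :
  chart_dom i p -> chart_dom j p -> chart_dom k p ->
  'd (transition j k) (chart_map j p) ('d (transition i j) (chart_map i p) w) =
  'd (transition i k) (chart_map i p) w.
Proof.
move=> ip jp kp.
have dij := transition_diff ip jp; have djk := transition_diff jp kp.
apply: (diff_comp_near w (transition_chart_map j ip) dij djk
          (transition_diff ip kp)).
have ci : (chart_map i @` chart_dom i) (chart_map i p) by exists p.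
have cinv := chart_inv_continuous ci.
have nj : nbhs (chart_inv i (chart_map i p)) (chart_dom j).
  rewrite (chart_mapK ip).
  by apply: open_nbhs_nbhs; split; [exact: chart_dom_open|exact: jp].
have nx : nbhs (chart_map i p) (chart_inv i @^-1` chart_dom j).
  by exact: cinv nj.
near=> x; rewrite /transition /=; congr (chart_map k _); apply: chart_mapK.
near: x; exact: nx.
Unshelve. all: by end_near.
Qed.

Lemma transition_id p i (w : 'rV[R]_n) : chart_dom i p ->
  'd (transition i i) (chart_map i p) w = w.
Proof.
move=> ip; have d := transition_diff ip ip.
rewrite -(deriveE w d) -[RHS](@derive_id R 'rV[R]_n (chart_map i p) w).
apply: near_eq_derive.
have : nbhs (chart_map i p) (chart_map i @` chart_dom i).
  by apply: open_nbhs_nbhs; split; [exact: chart_image_open|exists p].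
by apply: filterS => _ [q iq <-]; rewrite transition_chart_map.
Qed.

(* A tangent vector at p is the family of its components in all the charts
   around p, related by the Jacobians of the transition maps; the components
   in the charts that do not contain p are set to 0. *)
Definition tangent_family p : {pred chart M -> 'rV[R]_n} := fun v =>
  `[< (forall i, ~ chart_dom i p -> v i = 0) /\
      (forall i j, chart_dom i p -> chart_dom j p ->
         v j = 'd (transition i j) (chart_map i p) (v i)) >].

Lemma tangent_family_submod p : GRing.submod_closed (tangent_family p).
Proof.
split.
  by apply/asboolP; split => // i j ip jp; rewrite linear0.
move=> a u v /asboolP[u0 uE] /asboolP[v0 vE]; apply/asboolP.
have E l : (a *: u + v) l = a *: u l + v l by [].
split=> [i ip|i j ip jp].
  by rewrite E u0// v0// scaler0 add0r.
by rewrite !E (uE i j)// (vE i j)// linearP.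
Qed.

HB.instance Definition _ p :=
  GRing.isSubmodClosed.Build R _ (tangent_family p) (tangent_family_submod p).

Record tangent p := Tangent {
  component : chart M -> 'rV[R]_n ;
  _ : component \in tangent_family p }.

HB.instance Definition _ p := [isSub for @component p].
HB.instance Definition _ p := [Choice of tangent p by <:].
HB.instance Definition _ p := [SubChoice_isSubLmodule of tangent p by <:].

Lemma component0 p (v : tangent p) i : ~ chart_dom i p -> component v i = 0.
Proof. by case: v => v /= /asboolP[v0 _]; exact: v0. Qed.

Lemma componentE p (v : tangent p) i j : chart_dom i p -> chart_dom j p ->
  component v j = 'd (transition i j) (chart_map i p) (component v i).
Proof. by case: v => v /= /asboolP[_ vE]; exact: vE. Qed.

Lemma component_inj p i (u v : tangent p) :
  chart_dom i p -> component u i = component v i -> u = v.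
Proof.
move=> ip uv; apply/val_inj/funext => j /=.
have [jp|njp] := pselect (chart_dom j p); last by rewrite !component0.
by rewrite (componentE u ip jp) (componentE v ip jp) uv.
Qed.

Definition chart_vector_family i p (w : 'rV[R]_n) (j : chart M) : 'rV[R]_n :=
  if `[< chart_dom i p /\ chart_dom j p >]
  then 'd (transition i j) (chart_map i p) w else 0.

Lemma chart_vector_subproof i p (w : 'rV[R]_n) :
  chart_vector_family i p w \in tangent_family p.
Proof.
rewrite /chart_vector_family; apply/asboolP; split=> [j njp|j k jp kp].
  by rewrite asboolF// => -[].
have [ip|nip] := pselect (chart_dom i p); last first.
  by rewrite !asboolF ?linear0// => -[].
by rewrite !asboolT//; apply/esym; exact: transition_cocycle.
Qed.

(* The tangent vector at p with component w in the chart i (0 if p lies outside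
   [chart_dom i]); for w the a-th basis vector, this is the coordinate vector field
   d/dx^a of the chart i. *)
Definition chart_vector i p (w : 'rV[R]_n) : tangent p :=
  Tangent (chart_vector_subproof i p w).

Lemma chart_vectorK i p (w : 'rV[R]_n) :
  chart_dom i p -> component (chart_vector i p w) i = w.
Proof.
move=> ip; rewrite /= /chart_vector_family asboolT//; exact: transition_id.
Qed.

Lemma tangent_vector_axiom p : Vector.axiom n (tangent p).
Proof.
have [i ip] := cid (chart_dom_cover p).
exists (fun v : tangent p => component v i); first by [].
exists (chart_vector i p) => w; last exact: chart_vectorK.
by apply: (component_inj ip); exact: chart_vectorK.
Qed.

HB.instance Definition _ p :=
  Lmodule_hasFinDim.Build R (tangent p) (tangent_vector_axiom p).

End TangentSpace.

Section Tensors.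
Context {R : realType} {n : nat} {M : smoothManifold R n}.
Implicit Types p : M.

Definition cotangent p := 'Hom(tangent p, R^o).

(* A 2-covariant tensor T at p is curried, [T u v] being T(u, v): it is the
   same thing as the linear map T^ : T_pM -> T_p^*M, u |-> T(u, _). *)
Definition tensor2 p := 'Hom(tangent p, cotangent p).

Definition eval_at p (T : tensor2 p) (u v : tangent p) : R^o := T v u.

Fact eval_at_linear p (T : tensor2 p) (u : tangent p) : linear (eval_at T u).
Proof.
by move=> a v w; rewrite /eval_at linearP add_lfunE scale_lfunE.
Qed.

HB.instance Definition _ p (T : tensor2 p) (u : tangent p) :=
  GRing.isLinear.Build R (tangent p) R^o _ (eval_at T u) (eval_at_linear T u).

Definition tensor_transpose_row p (T : tensor2 p) (u : tangent p) :
    cotangent p :=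
  linfun (eval_at T u).

Fact tensor_transpose_row_linear p (T : tensor2 p) :
  linear (tensor_transpose_row T).
Proof.
move=> a u v; apply/lfunP => w.
by rewrite add_lfunE scale_lfunE !lfunE /= /eval_at linearP.
Qed.

HB.instance Definition _ p (T : tensor2 p) :=
  GRing.isLinear.Build R (tangent p) (cotangent p) _ (tensor_transpose_row T)
    (tensor_transpose_row_linear T).

Definition tensor_transpose p (T : tensor2 p) : tensor2 p :=
  linfun (tensor_transpose_row T).

Lemma tensor_transposeE p (T : tensor2 p) u v : tensor_transpose T u v = T v u.
Proof. by rewrite lfunE /= lfunE. Qed.

Definition skew_part p (T : tensor2 p) : tensor2 p :=
  2^-1 *: (T - tensor_transpose T).

Definition sym_part p (T : tensor2 p) : tensor2 p :=
  2^-1 *: (T + tensor_transpose T).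

Lemma skew_partE p (T : tensor2 p) u v :
  skew_part T u v = 2^-1 * (T u v - T v u).
Proof.
by rewrite !(scale_lfunE, add_lfunE, opp_lfunE) tensor_transposeE.
Qed.

Lemma sym_partE p (T : tensor2 p) u v :
  sym_part T u v = 2^-1 * (T u v + T v u).
Proof. by rewrite !(scale_lfunE, add_lfunE) tensor_transposeE. Qed.

Definition Ker p (T : tensor2 p) : {vspace tangent p} := lker T.

Definition tensor_rank p (T : tensor2 p) : nat := \dim (limg T).

Definition nondegenerate_tensor p (T : tensor2 p) : Prop := bijective T.

(* The bivector (Lambda^2 T^^-1)(w), as a function of two covectors. *)
Definition Lambda2_inv p (T w : tensor2 p) (a b : cotangent p) : R :=
  w ((T^-1)%VF a) ((T^-1)%VF b).

End Tensors.

(* The component functions of T in every chart are smooth. *)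
Definition smooth_tensor2 (R : realType) (n : nat) (M : smoothManifold R n)
    (T : forall p : M, tensor2 p) : Prop :=
  forall (i : chart M) (a b : 'I_n),
    smooth_on (chart_map i @` chart_dom i)
      (fun x => T (chart_inv i x)
                  (chart_vector i (chart_inv i x) (delta_mx 0 a))
                  (chart_vector i (chart_inv i x) (delta_mx 0 b)) : R^o).

Record tensorField2 (R : realType) (n : nat) (M : smoothManifold R n) :=
  TensorField2 {
    tensor_at :> forall p : M, tensor2 p ;
    tensor_at_smooth : smooth_tensor2 tensor_at }.

Definition constant_rank (R : realType) (n : nat) (M : smoothManifold R n)
    (T : forall p : M, tensor2 p) : Prop :=
  exists r : nat, forall p : M, tensor_rank (T p) = r.

(* Main.v *)
Require Import Defs.
From HB Require Import structures.
From mathcomp Require Import all_boot all_order all_algebra finmap.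
From mathcomp Require Import all_classical all_reals all_analysis.
From mathcomp Require Import ring lra.

Import Order.TTheory GRing.Theory Num.Theory.
Import numFieldNormedType.Exports.

(** Write Pi for the bivector (Lambda^2 B^-1)(omega).  It has constant rank, because
    omega does, and the theorem is in fact about such a bivector: the rest of B is
    forgotten.  Choose a Riemannian metric g on M, let D be the image of Pi in TM
    and K the g-orthogonal complement of D.  The inverse of the restriction of g to
    K is a symmetric form Q on T*M, whose kernel is the annihilator of K; the kernel
    of Pi is the annihilator of D, which is g(K).  These two are complementary, so
    Q - Pi is non-degenerate, and B' is its inverse.  It coincides with g on K and
    with the inverse of - Pi on D; its skew-symmetric part vanishes exactly on K and
    its symmetric part exactly on D, whence TM = K + D is the required splitting.
    Finally (Lambda^2 B'^-1)(omega') is the skew-symmetric part of the transpose of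
    B'^-1 ([bivectorE]), that is of Q + Pi, which is Pi ([adapted_bivector]).

    At a point this is matrix algebra ([adapted], [kernel_splitting]).  To glue over
    the charts, Q does not depend on the basis of K in which it is computed
    ([dual_form_unique]), so that B' transforms as a tensor ([adapted_congr]).  Its
    matrix is smooth because a subspace Ker(g Pi) of constant dimension has a smooth
    local frame, given by an explicit formula ([kernel_frameP]), and the rest of the
    construction is made of products and inverses of matrices ([smooth_adapted]).

    The metric comes from bump functions.  They are obtained from exp(-1/t)
    ([flat_smooth]) by pulling back balls of R^n, and paracompactness provides a
    locally finite family of them without common zero ([locally_finite_bumps]); the
    Euclidean metrics of the charts, weighted by these bumps, add up to a positive
    definite form ([riemannian_metric]). *)

Set Implicit Arguments.
Unset Strict Implicit.
Unset Printing Implicit Defensive.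

Local Open Scope classical_set_scope.
Local Open Scope ring_scope.

(** * Calculus of C^k functions and of smooth matrix-valued maps *)

Section CkCalculus.
Context {R : realType} {V : normedModType R}.
Implicit Types (U : set V) (k : nat).

(** [Ck_on] only ever tests its function at points of U, which makes it a
    conjunction over those points; smoothness can therefore be checked locally. *)
Lemma Ck_on_pointwise (W : normedModType R) k U (f : V -> W) :
  (forall x, U x -> Ck_on k [set x] f) -> Ck_on k U f.
Proof.
elim: k f => [|k IH] f H /=; first by move=> x Ux; exact: H Ux x erefl.
split=> [x Ux|v]; first by have [+ _] := H x Ux; exact.
by apply: IH => x Ux; have [_ +] := H x Ux; exact.
Qed.

Lemma Ck_on_subset (W : normedModType R) k U U' (f : V -> W) :
  U' `<=` U -> Ck_on k U f -> Ck_on k U' f.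
Proof.
move=> sU; elim: k f => [|k IH] f /= H; first by move=> x /sU; exact: H.
by case: H => H1 H2; split=> [x /sU/H1//|v]; apply: IH.
Qed.

Lemma Ck_on_le (W : normedModType R) k U (f : V -> W) :
  Ck_on k.+1 U f -> Ck_on k U f.
Proof.
elim: k f => [|k IH] f [df Df] /=.
  by move=> x Ux; apply: differentiable_continuous; exact: df.
by split=> // v; apply: IH; exact: Df.
Qed.

(** The two Landau remainders coincide near the point. *)
Lemma near_eq_differentiable (W : normedModType R) (f g : V -> W) x :
  (\near x, f x = g x) -> differentiable f x -> differentiable g x.
Proof.
move=> fg df; have dfc := diff_continuous df.
have := diff_locally df; move/eqaddoP => dfo.
have gxE : g \o shift x = cst (g x) + 'd f x +o_ (0 : V) id.
  apply/eqaddoP => e e0; near=> h.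
  have -> : (g \o shift x - (cst (g x) + 'd f x)) h =
      (f \o shift x - (cst (f x) + 'd f x)) h.
    rewrite /= !fctE /= -(nbhs_singleton fg); congr (_ - _); apply/esym.
    by near: h; move: fg; rewrite (near_shift (0 : V)) subr0.
  by near: h; exact: dfo.
apply/diff_locallyP; split; last by rewrite (diff_unique dfc gxE).
by rewrite (diff_unique dfc gxE).
Unshelve. all: by end_near. Qed.

(** Openness of U lets two functions that agree on U have the same iterated
    derivatives there; each rule of calculus below is transported through it. *)
Lemma Ck_on_eq (W : normedModType R) k U (f g : V -> W) : open U ->
  (forall x, U x -> f x = g x) -> Ck_on k U f -> Ck_on k U g.
Proof.
move=> oU; have nU (f' g' : V -> W) x : (forall x, U x -> f' x = g' x) ->
    U x -> \near x, f' x = g' x.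
  by move=> fg Ux; apply: filterS fg _; exact: open_nbhs_nbhs.
elim: k f g => [|k IH] f g fg /=.
  move=> cf x Ux; rewrite /prop_for/continuous_at -(fg _ Ux).
  apply: cvg_trans (cf x Ux); apply: near_eq_cvg.
  by apply: nU => // y Uy; rewrite fg.
case=> df Df; split=> [x Ux|v].
  by apply: near_eq_differentiable (nU _ _ x fg Ux) _; exact: df.
apply: IH (Df v) => x Ux; apply: near_eq_derive; exact: nU.
Qed.

Lemma Ck_on_cst (W : normedModType R) k U (c : W) : Ck_on k U (fun _ : V => c).
Proof.
elim: k c => [|k IH] c /=; first by move=> x _; exact: cst_continuous.
split=> [x _|v]; first exact: differentiable_cst.
by have -> : (fun x => 'D_v (fun _ : V => c) x) = (fun=> 0);
  [apply/funext => x; exact: derive_cst|exact: IH].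
Qed.

Lemma Ck_on_add (W : normedModType R) k U (f g : V -> W) : open U ->
  Ck_on k U f -> Ck_on k U g -> Ck_on k U (fun x => f x + g x).
Proof.
move=> oU; elim: k f g => [|k IH] f g /=.
  by move=> cf cg x Ux; exact: (cvgD (cf x Ux) (cg x Ux)).
move=> [df Df] [dg Dg]; split=> [x Ux|v].
  by apply: differentiableD; [exact: df|exact: dg].
apply: (Ck_on_eq oU _ (IH _ _ (Df v) (Dg v))) => x Ux.
by rewrite -deriveD//; apply: diff_derivable; [exact: df|exact: dg].
Qed.

Lemma Ck_on_mul k U (f g : V -> R^o) : open U ->
  Ck_on k U f -> Ck_on k U g -> Ck_on k U (fun x => f x * g x : R^o).
Proof.
move=> oU; elim: k f g => [|k IH] f g /=.
  by move=> cf cg x Ux; exact: (cvgM (cf x Ux) (cg x Ux)).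
move=> [df Df] [dg Dg]; split=> [x Ux|v].
  by apply: differentiableM; [exact: df|exact: dg].
have fk : Ck_on k U f by exact: Ck_on_le.
have gk : Ck_on k U g by exact: Ck_on_le.
apply: (Ck_on_eq oU _ (Ck_on_add oU (IH _ _ fk (Dg v)) (IH _ _ gk (Df v)))).
move=> x Ux.
rewrite -[LHS](@deriveM R V f g)//.
  by apply: diff_derivable; exact: df.
by apply: diff_derivable; exact: dg.
Qed.

Lemma Ck_on_inv k U (f : V -> R^o) : open U -> (forall x, U x -> f x != 0) ->
  Ck_on k U f -> Ck_on k U (fun x => (f x)^-1 : R^o).
Proof.
move=> oU f0; elim: k => [|k IH] /=.
  by move=> cf x Ux; exact: (cvgV (f0 x Ux) (cf x Ux)).
move=> [df Df]; split=> [x Ux|v].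
  by apply: (@differentiableV R V f); [exact: df|exact: f0].
have fk : Ck_on k U f by exact: Ck_on_le.
have := Ck_on_mul oU (Ck_on_mul oU (Ck_on_cst k U (-1 : R^o)) (IH fk)) (IH fk).
move=> /(fun h => Ck_on_mul oU h (Df v)); apply: (Ck_on_eq oU) => x Ux.
rewrite (@deriveV R V f) ?f0//; last by apply: diff_derivable; exact: df.
by rewrite /GRing.scale/= expr2 invfM mulN1r mulNr.
Qed.

Lemma Ck_on_coord m n k U (f : V -> 'M[R]_(m, n)) i j : open U ->
  Ck_on k U f -> Ck_on k U (fun x => f x i j : R^o).
Proof.
move=> oU; elim: k f => [|k IH] f /=.
  move=> cf x Ux; apply: (@continuous_comp V 'M[R]_(m, n) R^o f (fun N => N i j)).
    exact: cf.
  exact: coord_continuous.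
move=> [df Df]; split=> [x Ux|v].
  apply: (@differentiable_comp R V 'M[R]_(m, n) R^o f (fun N => N i j)).
    exact: df.
  exact: differentiable_coord.
apply: (Ck_on_eq oU _ (IH _ (Df v))) => x Ux.
by rewrite derive_mx ?mxE//; apply: diff_derivable; exact: df.
Qed.

Lemma Ck_on_sum k U (I : Type) (r : seq I) (F : I -> V -> R^o) : open U ->
  (forall i, Ck_on k U (F i)) -> Ck_on k U (fun x => \sum_(i <- r) F i x).
Proof.
move=> oU HF; elim: r => [|a r IH].
  by under [X in Ck_on _ _ X]eq_fun do rewrite big_nil; exact: Ck_on_cst.
by under [X in Ck_on _ _ X]eq_fun do rewrite big_cons; exact: Ck_on_add.
Qed.

Lemma Ck_on_prod k U (I : Type) (r : seq I) (F : I -> V -> R^o) : open U ->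
  (forall i, Ck_on k U (F i)) -> Ck_on k U (fun x => \prod_(i <- r) F i x : R^o).
Proof.
move=> oU HF; elim: r => [|a r IH].
  by under [X in Ck_on _ _ X]eq_fun do rewrite big_nil; exact: Ck_on_cst.
by under [X in Ck_on _ _ X]eq_fun do rewrite big_cons; exact: Ck_on_mul.
Qed.

(** The chain rule expands the derivative of f o g along v as the sum over a of
    (D_v g)_a (D_a f) o g, whose terms are covered by the induction on k. *)
Lemma Ck_on_comp n k U (U' : set 'rV[R]_n) (f : 'rV[R]_n -> R^o) (g : V -> 'rV[R]_n) :
  open U -> (forall x, U x -> U' (g x)) ->
  Ck_on k U' f -> Ck_on k U g -> Ck_on k U (fun x => f (g x)).
Proof.
move=> oU gU; elim: k f g gU => [|k IH] f g gU /=.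
  move=> cf cg x Ux; apply: (@continuous_comp V 'rV[R]_n R^o g f); first exact: cg.
  by apply: cf; exact: gU.
move=> [df Df] [dg Dg]; split=> [x Ux|v].
  apply: (@differentiable_comp R V 'rV[R]_n R^o g f); first exact: dg.
  by apply: df; exact: gU.
have gk : Ck_on k U g by exact: Ck_on_le.
have H := Ck_on_sum (index_enum 'I_n) oU (fun a => Ck_on_mul oU
  (Ck_on_coord 0 a oU (Dg v)) (IH _ _ gU (Df (delta_mx 0 a)) gk)).
apply: (Ck_on_eq oU _ H) => x Ux.
have dgx := dg x Ux; have dfx := df _ (gU x Ux).
rewrite (deriveE v (differentiable_comp dgx dfx)) (diff_comp dgx dfx) /=.
rewrite -(deriveE v dgx) [in RHS](row_sum_delta ('D_v g x)) linear_sum /=.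
by apply: eq_bigr => a _; rewrite linearZ /= (deriveE _ dfx).
Qed.

Lemma Ck_on_comp_scalar k U (U' : set R^o) (f : R^o -> R^o) (g : V -> R^o) :
  open U -> (forall x, U x -> U' (g x)) ->
  Ck_on k U' f -> Ck_on k U g -> Ck_on k U (fun x => f (g x)).
Proof.
move=> oU gU; elim: k f g gU => [|k IH] f g gU /=.
  move=> cf cg x Ux; apply: (@continuous_comp V R^o R^o g f); first exact: cg.
  by apply: cf; exact: gU.
move=> [df Df] [dg Dg]; split=> [x Ux|v].
  apply: (@differentiable_comp R V R^o R^o g f); first exact: dg.
  by apply: df; exact: gU.
have gk : Ck_on k U g by exact: Ck_on_le.
have H := Ck_on_mul oU (Dg v) (IH _ _ gU (Df (1 : R^o)) gk).
apply: (Ck_on_eq oU _ H) => x Ux.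
have dgx := dg x Ux; have dfx := df _ (gU x Ux).
rewrite (deriveE v (differentiable_comp dgx dfx)) (diff_comp dgx dfx) /=.
rewrite -(deriveE v dgx) (deriveE _ dfx).
have {2}-> : 'D_v g x = 'D_v g x *: (1 : R^o) by rewrite /GRing.scale/= mulr1.
by rewrite linearZ.
Qed.

Lemma Ck_on_linear k U (f : V -> R^o) : linear f -> continuous f -> Ck_on k U f.
Proof.
move=> lf cf; pose L := GRing.isLinear.Build R V R^o _ f lf.
pose F : {linear V -> R^o} := HB.pack f L.
case: k => [|k] /=; first by move=> x _; exact: cf.
have dF x : differentiable f x by exact: (@linear_differentiable R V R^o F).
split=> [x _|v]; first exact: dF.
have -> : (fun x => 'D_v f x) = (fun=> f v); last exact: Ck_on_cst.
apply/funext => x; rewrite deriveE//.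
by rewrite (@diff_lin R V R^o F).
Qed.

Definition smooth_mx m n U (A : V -> 'M[R]_(m, n)) : Prop :=
  forall i j, smooth_on U (fun x => A x i j : R^o).

Section SmoothMatrices.
Variables (U : set V) (oU : open U).

Lemma smooth_mx_eq m n (A B : V -> 'M[R]_(m, n)) :
  (forall x, U x -> A x = B x) -> smooth_mx U A -> smooth_mx U B.
Proof.
by move=> AB sA i j k; apply: (Ck_on_eq oU _ (sA i j k)) => x /AB ->.
Qed.

Lemma smooth_mx_subset m n U' (A : V -> 'M[R]_(m, n)) :
  U' `<=` U -> smooth_mx U A -> smooth_mx U' A.
Proof. by move=> sU sA i j k; exact: Ck_on_subset (sA i j k). Qed.

Lemma smooth_mx_cst m n (A : 'M[R]_(m, n)) : smooth_mx U (fun=> A).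
Proof. by move=> i j k; exact: Ck_on_cst. Qed.

Lemma smooth_mx_add m n (A B : V -> 'M[R]_(m, n)) :
  smooth_mx U A -> smooth_mx U B -> smooth_mx U (fun x => A x + B x).
Proof.
move=> sA sB i j k; apply: (Ck_on_eq oU _ (Ck_on_add oU (sA i j k) (sB i j k))).
by move=> x _; rewrite mxE.
Qed.

Lemma smooth_mx_scale m n (c : V -> R^o) (A : V -> 'M[R]_(m, n)) :
  smooth_on U c -> smooth_mx U A -> smooth_mx U (fun x => c x *: A x).
Proof.
move=> sc sA i j k; apply: (Ck_on_eq oU _ (Ck_on_mul oU (sc k) (sA i j k))).
by move=> x _; rewrite mxE.
Qed.

Lemma smooth_mx_sum m n (I : Type) (r : seq I) (A : I -> V -> 'M[R]_(m, n)) :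
  (forall l, smooth_mx U (A l)) -> smooth_mx U (fun x => \sum_(l <- r) A l x).
Proof.
move=> sA i j k.
apply: (Ck_on_eq oU _ (Ck_on_sum r oU (fun l => sA l i j k))) => x _.
by rewrite summxE.
Qed.

Lemma smooth_mx_opp m n (A : V -> 'M[R]_(m, n)) :
  smooth_mx U A -> smooth_mx U (fun x => - A x).
Proof.
move=> sA; apply: (smooth_mx_eq _ (smooth_mx_scale (c := fun=> -1) _ sA)).
  by move=> x _; rewrite scaleN1r.
by move=> k; exact: Ck_on_cst.
Qed.

Lemma smooth_mx_tr m n (A : V -> 'M[R]_(m, n)) :
  smooth_mx U A -> smooth_mx U (fun x => (A x)^T).
Proof.
by move=> sA i j k; apply: (Ck_on_eq oU _ (sA j i k)) => x _; rewrite mxE.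
Qed.

Lemma smooth_mx_mul m n p (A : V -> 'M[R]_(m, n)) (B : V -> 'M[R]_(n, p)) :
  smooth_mx U A -> smooth_mx U B -> smooth_mx U (fun x => A x *m B x).
Proof.
move=> sA sB i j k.
apply: (Ck_on_eq oU _ (Ck_on_sum (index_enum 'I_n) oU
  (fun l => Ck_on_mul oU (sA i l k) (sB l j k)))).
by move=> x _; rewrite mxE.
Qed.

Lemma smooth_det n (A : V -> 'M[R]_n) :
  smooth_mx U A -> smooth_on U (fun x => \det (A x) : R^o).
Proof.
move=> sA k; apply: Ck_on_sum => // s; apply: Ck_on_mul => //.
  exact: Ck_on_cst.
by apply: Ck_on_prod => // i; exact: sA.
Qed.

Lemma smooth_mx_inv n (A : V -> 'M[R]_n) : (forall x, U x -> A x \in unitmx) ->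
  smooth_mx U A -> smooth_mx U (fun x => invmx (A x)).
Proof.
move=> uA sA.
have detA x : U x -> \det (A x) != 0.
  by move=> /uA; rewrite unitmxE unitfE.
have sdet : smooth_on U (fun x => (\det (A x))^-1 : R^o).
  by move=> k; apply: Ck_on_inv => //; exact: smooth_det.
have sadj : smooth_mx U (fun x => \adj (A x)).
  move=> i j k.
  have sminor : smooth_mx U (fun x => row' j (col' i (A x))).
    move=> a b l; apply: (Ck_on_eq oU _ (sA (lift j a) (lift i b) l)) => x _.
    by rewrite !mxE.
  apply: (Ck_on_eq oU _ (Ck_on_mul oU (Ck_on_cst k U ((-1) ^+ (j + i) : R^o))
    (smooth_det sminor k))) => x _.
  by rewrite mxE.
apply: (smooth_mx_eq _ (smooth_mx_scale sdet sadj)) => x Ux.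
by rewrite /invmx uA.
Qed.

(** Invertibility is the non-vanishing of the determinant, an open condition. *)
Lemma open_unitmx n (A : V -> 'M[R]_n) : smooth_mx U A ->
  open (U `&` [set x | A x \in unitmx]).
Proof.
move=> sA; have cdet := smooth_det sA 0.
rewrite openE => x [Ux /= Ax].
have d0 : (\det (A x) : R^o) != 0 by move: Ax; rewrite unitmxE unitfE.
have N : nbhs (\det (A x) : R^o) [set y : R^o | y != 0].
  by apply: open_nbhs_nbhs; split; [exact: open_neq|].
apply: filterI; first exact: open_nbhs_nbhs.
have H : nbhs x ((fun y => \det (A y) : R^o) @^-1` [set y | y != 0]).
  exact: cdet x Ux _ N.
by apply: filterS H => y /=; rewrite unitmxE unitfE.
Qed.

End SmoothMatrices.

End CkCalculus.

(** * Smooth bump functions on R^n *)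

Section SmoothBump.
Context {R : realType}.

(** For m = 0 this is the classical smooth function exp(-1/t) extended by 0.  The
    whole family over m is needed because it is stable under derivation up to
    linear combinations: flat_m' = - m flat_(m+1) + flat_(m+2). *)
Definition flat (m : nat) (t : R^o) : R^o :=
  if 0 < t then t^-1 ^+ m * expR (- t^-1) else 0.

(** The exponential series gives exp(s) >= s^(m+2) / (m+2)! at s = 1/t; the
    quadratic bound makes the difference quotient at 0 tend to 0. *)
Lemma flat_le m (t : R) : `|flat m t| <= m.+2`!%:R * t ^+ 2.
Proof.
rewrite /flat; case: ifPn => [t0|_]; last first.
  by rewrite normr0 mulr_ge0// ?ler0n// sqr_ge0.
have s0 : 0 < t^-1 by rewrite invr_gt0.
rewrite ger0_norm; last by rewrite mulr_ge0 ?expR_ge0// exprn_ge0// ltW.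
have E : t^-1 ^+ m.+2 / m.+2`!%:R <= expR t^-1.
  apply: le_trans (expR_ge1Dxn m.+1 (ltW s0)).
  by rewrite lerDr.
rewrite expRN ler_pdivrMr ?expR_gt0//.
have f0 : 0 < (m.+2`!%:R : R) by rewrite ltr0n fact_gt0.
have -> : t^-1 ^+ m = (m.+2`!%:R * t ^+ 2) * (t^-1 ^+ m.+2 / m.+2`!%:R).
  rewrite !(exprS _ m.+1) !(exprS _ m); move: (t^-1 ^+ m) => a.
  by field; rewrite (gt_eqF t0) (gt_eqF f0).
by rewrite ler_wpM2l// mulr_ge0// ?ltW// exprn_gt0.
Qed.

Lemma is_derive_flat m (x : R) :
  is_derive x 1 (flat m) (- m%:R * flat m.+1 x + flat m.+2 x).
Proof.
have [x0|x0|<-] := ltgtP 0 x.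
- rewrite /flat x0.
  apply: (@near_eq_is_derive R R^o R^o (fun t : R => t^-1 ^+ m * expR (- t^-1))).
    have : \forall t \near x, 0 < t by exact: lt_nbhsr.
    by apply: filterS => t ->.
  have xn : x != 0 by rewrite gt_eqF.
  have Dv : is_derive x 1 (fun t : R => t^-1) (- x ^- 2).
    apply: DeriveDef; first by apply: derivableV.
    by rewrite (@deriveV _ _ id)// derive_id /GRing.scale /= mulr1.
  have Dn : is_derive x 1 (fun t : R => - t^-1) (x ^- 2).
    by rewrite -[x ^- 2]opprK; exact: is_deriveN.
  have De : is_derive x 1 (fun t : R => expR (- t^-1)) (x ^- 2 * expR (- x^-1)).
    by rewrite mulrC; exact: (is_derive1_comp (f := expR)).
  have Dp : is_derive x 1 (fun t : R => t^-1 ^+ m) (m%:R * x^-1 ^+ m.-1 * - x ^- 2).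
    have -> : (fun t : R => t^-1 ^+ m) = (fun t : R => t^-1) ^+ m.
      by rewrite exprfctE.
    exact: (@is_deriveX _ _ _ m x 1 _ Dv).
  have := @is_deriveM _ _ _ _ x 1 _ _ Dp De.
  rewrite /GRing.scale /=.
  move/is_derive_eq; apply.
  move: (expR _) => e; case: m Dp => [|m] _ /=.
    by rewrite !expr0; field.
  by rewrite !exprS; move: (x^-1 ^+ m) => a; field.
- have fx0 k : flat k x = 0 by rewrite /flat lt_gtF.
  rewrite !fx0 mulr0 addr0.
  apply: (@near_eq_is_derive R R^o R^o (fun=> 0)).
  have : \forall t \near x, t < 0 by exact: lt_nbhsl.
  by apply: filterS => t t0; rewrite /flat lt_gtF.
- have fx0 k : flat k 0 = 0 by rewrite /flat ltxx.
  rewrite !fx0 mulr0 addr0.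
  have H : h^-1 *: (flat m (h *: 1 + 0) - flat m 0) @[h --> (0 : R)^'] --> (0 : R).
    have f0 : 0 < (m.+2`!%:R : R) by rewrite ltr0n fact_gt0.
    apply/cvgrPdist_le => e e0; near=> h.
    have h0 : h != 0 by near: h; exact: nbhs_dnbhs_neq.
    have hn : 0 < `|h| by rewrite normr_gt0.
    have -> : h^-1 *: (flat m (h *: 1 + 0) - flat m 0) = h^-1 * flat m h.
      by rewrite addr0 fx0 subr0 [h *: 1]mulr1.
    rewrite sub0r normrN normrM normfV ler_pdivrMl//.
    apply: le_trans (flat_le m h) _.
    rewrite -real_normK ?num_real// expr2 mulrCA ler_pM2l//.
    rewrite -ler_pdivlMl//; near: h.
    by apply: dnbhs0_le; rewrite mulr_gt0// invr_gt0.
  apply: DeriveDef; first by apply/cvg_ex; exists 0.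
  exact/cvg_lim.
Unshelve. all: by end_near. Qed.

(** Induction on the order of differentiability, for all m at once, since the
    derivative of [flat m] involves the two next members of the family. *)
Lemma flat_smooth m k : Ck_on k setT (flat m).
Proof.
elim: k m => [|k IH] m.
  move=> x _; apply: differentiable_continuous; apply/derivable1_diffP.
  by have [] := is_derive_flat m x.
have df x : differentiable (flat m) x.
  by apply/derivable1_diffP; have [] := is_derive_flat m x.
split=> [x _|v]; first exact: df.
have oT := @openT R^o.
have H := Ck_on_mul oT (Ck_on_cst k setT (v : R^o))
  (Ck_on_add oT (Ck_on_mul oT (Ck_on_cst k setT (- m%:R : R^o)) (IH m.+1)) (IH m.+2)).
apply: (Ck_on_eq oT _ H) => x _.
have [_ Dx] := is_derive_flat m x.
rewrite deriveE//; have -> : v = v *: (1 : R^o) by rewrite /GRing.scale/= mulr1.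
by rewrite linearZ /= -deriveE// Dx /GRing.scale/= mulr1.
Qed.


Lemma flat_gt0 m (t : R) : (0 < flat m t) = (0 < t).
Proof.
rewrite /flat; case: ifPn => [t0|_]; last by rewrite ltxx.
by rewrite mulr_gt0 ?expR_gt0// exprn_gt0// invr_gt0.
Qed.

Lemma flat_ge0 m (t : R) : 0 <= flat m t.
Proof.
have := flat_gt0 m t; rewrite /flat; case: ifPn => // _; exact: ltW.
Qed.

Context {n : nat}.
Implicit Types (c x : 'rV[R]_n) (r : R).

(** The Euclidean distance is used, its square being a polynomial; the support is
    then controlled in the sup norm of row vectors. *)
Definition ball_bump c r x : R^o :=
  flat 0 (r ^+ 2 - \sum_a (x 0 a - c 0 a) ^+ 2).

Lemma ball_bump_ge0 c r x : 0 <= ball_bump c r x.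
Proof. exact: flat_ge0. Qed.

Lemma ball_bump_center c r : 0 < r -> 0 < ball_bump c r c.
Proof.
move=> r0; rewrite flat_gt0 big1 => [|a _]; first by rewrite subr0 exprn_gt0.
by rewrite subrr expr0n.
Qed.

Lemma ball_bump_smooth c r : smooth_on setT (ball_bump c r).
Proof.
move=> k; have oT := @openT 'rV[R]_n; have Cc := @Ck_on_cst R 'rV[R]_n R^o k setT.
apply: (Ck_on_comp_scalar (U' := setT)) => //; first exact: flat_smooth.
apply: (@Ck_on_add _ _ R^o _ _ (fun=> r ^+ 2)) => //.
have Ct a : Ck_on k setT (fun x : 'rV[R]_n => x 0 a - c 0 a : R^o).
  apply: (@Ck_on_add _ _ R^o _ _ _ (fun=> - c 0 a)) => //.
  apply: (@Ck_on_linear _ _ _ _ (fun x : 'rV[R]_n => x 0 a : R^o)).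
    2: exact: coord_continuous.
  by move=> s x y; rewrite !mxE.
apply: (Ck_on_eq oT _ (Ck_on_mul oT (Cc (-1)) (Ck_on_sum (index_enum 'I_n) oT
  (fun a => Ck_on_mul oT (Ct a) (Ct a))))) => x _.
by rewrite mulN1r.
Qed.

Lemma ball_bump_support c r x : 0 < r -> ball_bump c r x != 0 -> `|c - x| <= r.
Proof.
move=> r0 bx; have : 0 < ball_bump c r x by rewrite lt0r bx ball_bump_ge0.
rewrite flat_gt0 subr_gt0 => xr.
rewrite /Num.Def.normr/= mx_normrE; apply: bigmax_le; first exact: ltW.
move=> [i a] _ /=; rewrite ord1 !mxE distrC.
rewrite -(ler_pXn2r (n := 2)) ?nnegrE ?(ltW r0)// real_normK ?num_real//.
apply: le_trans (ltW xr); rewrite (bigD1 a)//= lerDl; apply: sumr_ge0 => b _.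
exact: sqr_ge0.
Qed.

Lemma compact_closed_ball c r : 0 < r -> compact [set x | `|c - x| <= r].
Proof.
move=> r0; apply: bounded_closed_compact.
  exists (`|c| + r); split; first exact: num_real.
  move=> y yr x /= xr; apply: le_trans (ltW yr).
  by rewrite -[x](subKr c) (le_trans (ler_normB _ _))// lerD2l.
have -> : [set x | `|c - x| <= r] = closed_ball c r by rewrite closed_ballE.
exact: closed_ball_closed.
Qed.

End SmoothBump.

(** * Linear algebra of the adapted form *)

(** Vectors and covectors are rows: a form of matrix A sends (u, v) to u A v^T, and
    an isomorphism B from vectors to covectors sends u to u B. *)
Section AdaptedForms.
Context {F : realFieldType} {n : nat}.
Implicit Types (A B G P J : 'M[F]_n).

Definition posdef G : Prop :=
  G^T = G /\ forall v : 'rV_n, v != 0 -> 0 < (v *m G *m v^T) 0 0.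

(** If k is killed by the Gram matrix of the rows of W, then k W has length 0 for
    G, hence vanishes, and k = 0 as the rows are independent. *)
Lemma posdef_gram_unit m (W : 'M[F]_(m, n)) G : posdef G -> row_free W ->
  W *m G *m W^T \in unitmx.
Proof.
move=> [_ Gp] fW; rewrite -row_free_unit; apply/row_freeP.
have K0 : kermx (W *m G *m W^T) = 0.
  apply/row_matrixP => i; rewrite row0; set k := row i _.
  have k0 : k *m (W *m G *m W^T) = 0 by rewrite -row_mul mulmx_ker row0.
  apply/eqP; apply: contraT => kn0.
  have kW : k *m W != 0 by rewrite mulmx_free_eq0.
  have := Gp _ kW; rewrite trmx_mul !mulmxA in k0 *.
  by rewrite k0 mul0mx mxE ltxx.
by apply/row_freeP; rewrite -kermx_eq0 K0.
Qed.

Lemma posdef_unit G : posdef G -> G \in unitmx.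
Proof.
move=> Gp; have := posdef_gram_unit Gp (W := 1%:M).
by rewrite mul1mx trmx1 mulmx1; apply; rewrite row_free_unit unitmx1.
Qed.

(** The inverse of the restriction of G to the row space of W, as a form on
    covectors: its kernel is the annihilator of that subspace. *)
Definition dual_form m G (W : 'M[F]_(m, n)) : 'M[F]_n :=
  W^T *m invmx (W *m G *m W^T) *m W.

Section DualForm.
Variables (m : nat) (G : 'M[F]_n) (W : 'M[F]_(m, n)).
Hypotheses (Gp : posdef G) (fW : row_free W).

Lemma dual_form_sym : (dual_form G W)^T = dual_form G W.
Proof.
by rewrite /dual_form !trmx_mul trmx_inv !trmx_mul !trmxK !mulmxA (proj1 Gp).
Qed.

Lemma dual_form_sub : (dual_form G W <= W)%MS.
Proof. exact: submxMl. Qed.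

Lemma dual_formK p (k : 'M[F]_(p, n)) : (k <= W)%MS -> k *m G *m dual_form G W = k.
Proof.
move=> /submxP[a ->]; rewrite /dual_form !mulmxA -3!(mulmxA a).
by rewrite mulmxV ?mulmx1// posdef_gram_unit.
Qed.

(** Two forms with these properties satisfy Q = Q G Q' and, transposing,
    Q = Q' G Q, and the last product is Q'. *)
Lemma dual_form_unique Q : Q^T = Q -> (Q <= W)%MS -> W *m G *m Q = W ->
  Q = dual_form G W.
Proof.
move=> Qs /submxP[a Qa] WQ.
have QE : Q *m G *m dual_form G W = Q by rewrite dual_formK// Qa submxMl.
have := congr1 trmx QE; rewrite (trmx_mul _ (dual_form G W)) dual_form_sym.
rewrite trmx_mul Qs (proj1 Gp) => <-.
by rewrite /dual_form -!(mulmxA _ W) (mulmxA W) WQ.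
Qed.

End DualForm.

Lemma eqmx_dual_form m m' G (W : 'M[F]_(m, n)) (W' : 'M[F]_(m', n)) :
  posdef G -> row_free W -> row_free W' -> (W :=: W')%MS ->
  dual_form G W = dual_form G W'.
Proof.
move=> Gp fW fW' WW'; apply: dual_form_unique => //.
- exact: dual_form_sym.
- by rewrite -WW' dual_form_sub.
- by rewrite dual_formK// WW'.
Qed.

Lemma dual_form_congr m G (W : 'M[F]_(m, n)) J : J \in unitmx ->
  dual_form (J *m G *m J^T) (W *m invmx J) =
  (invmx J)^T *m dual_form G W *m invmx J.
Proof.
move=> uJ; have -> : dual_form (J *m G *m J^T) (W *m invmx J) =
    (W *m invmx J)^T *m invmx (W *m G *m W^T) *m (W *m invmx J).
  rewrite /dual_form; congr (_ *m invmx _ *m _).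
  rewrite trmx_mul !mulmxA mulmxKV// -(mulmxA _ J^T) -trmx_mul mulVmx//.
  by rewrite trmx1 mulmx1.
by rewrite trmx_mul /dual_form !mulmxA.
Qed.

(** Here P is a skew form on covectors (a bivector), Q plays the role of the
    inverse metric of K = Ker(G P), the orthogonal complement of the image D of P.
    On covectors, G K = Ker P and Ann K = Ker Q are complementary; Q - P is
    therefore invertible, and its inverse b coincides with G on K and with the
    inverse of - P on D. *)
Section Splitting.
Variables (G P Q : 'M[F]_n).
Hypotheses (Gp : posdef G) (Pskew : P^T = - P).
Hypotheses (Qs : Q^T = Q) (QGP : Q *m G *m P = 0).
Hypothesis QK : forall k : 'rV_n, k *m G *m P = 0 -> k *m G *m Q = k.

Let PGQ : P *m G *m Q = 0.
Proof.
apply: trmx_inj; rewrite trmx0 2!trmx_mul Qs (proj1 Gp) Pskew.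
by rewrite !mulmxN mulmxA QGP oppr0.
Qed.

Let QGQ : Q *m G *m Q = Q.
Proof.
apply/row_matrixP => i; rewrite !row_mul QK// -!row_mul.
by rewrite QGP row0.
Qed.

(** If beta (Q - P) = 0 then multiplying by G Q kills the P term, so beta lies in
    Ker Q and in Ker P = G K, on which Q is injective. *)
Lemma subr_skew_unit : Q - P \in unitmx.
Proof.
rewrite -row_free_unit -kermx_eq0; apply/eqP/row_matrixP => i; rewrite row0.
set b := row i _.
have b0 : b *m (Q - P) = 0 by rewrite -row_mul mulmx_ker row0.
have bQ : b *m Q = 0.
  have := congr1 (fun v => v *m (G *m Q)) b0.
  by rewrite mulmxBr mulmxBl mul0mx -!mulmxA !(mulmxA _ G) QGQ PGQ mulmx0 subr0.
have bP : b *m P = 0 by move/eqP: b0; rewrite mulmxBr bQ sub0r oppr_eq0 => /eqP.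
pose k := b *m invmx G.
have kG : k *m G = b by rewrite mulmxKV// posdef_unit.
have k0 : k = 0 by rewrite -(QK (k := k)) kG.
by rewrite -kG k0 mul0mx.
Qed.

Lemma addr_skew_unit : Q + P \in unitmx.
Proof.
rewrite -unitmx_tr; suff -> : (Q + P)^T = Q - P by exact: subr_skew_unit.
by rewrite linearD /= Qs Pskew.
Qed.

Lemma trmx_subr_skew : (Q - P)^T = Q + P.
Proof. by rewrite linearB /= Qs Pskew opprK. Qed.

(** With beta = v b, put k = beta Q in K and alpha = beta - k G in Ker Q; then
    v = k - alpha P.  Both b and b^T = (Q + P)^-1 send k to k G, whereas they send
    - alpha P to alpha and - alpha respectively: k is in the kernel of the skew
    part and - alpha P in the kernel of the symmetric one. *)
Lemma kernel_splitting (v : 'rV_n) (b := invmx (Q - P)) :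
  exists k d, [/\ v = k + d, k *m (b - b^T) = 0 & d *m (b + b^T) = 0].
Proof.
have bT : b^T = invmx (Q + P) by rewrite trmx_inv trmx_subr_skew.
have uB := subr_skew_unit; have uD := addr_skew_unit.
pose be := v *m b; pose k := be *m Q; pose a := be - k *m G.
have aQ : a *m Q = 0 by rewrite mulmxBl /k -!mulmxA (mulmxA Q G Q) QGQ subrr.
have kGP : k *m G *m P = 0 by rewrite /k -!mulmxA (mulmxA Q G P) QGP !mulmx0.
have kGQ : k *m G *m Q = k by rewrite /k -!mulmxA (mulmxA Q G Q) QGQ.
have vE : v = be *m (Q - P) by rewrite mulmxKV.
have beP : be *m P = a *m P by rewrite mulmxBl kGP subr0.
have kb : k *m b = k *m G.
  by rewrite -[k in LHS](_ : k *m G *m (Q - P) = k) ?mulmxK// mulmxBr kGQ kGP subr0.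
have kbT : k *m b^T = k *m G.
  by rewrite bT -[k in LHS](_ : k *m G *m (Q + P) = k) ?mulmxK// mulmxDr kGQ kGP addr0.
have ab : - (a *m P) *m b = a.
  by rewrite -(_ : a *m (Q - P) = - (a *m P)) ?mulmxK// mulmxBr aQ sub0r.
have abT : - (a *m P) *m b^T = - a.
  rewrite bT mulNmx; congr (- _).
  by rewrite -(_ : a *m (Q + P) = a *m P) ?mulmxK// mulmxDr aQ add0r.
exists k, (- (a *m P)); split.
- by rewrite {1}vE mulmxBr beP.
- by rewrite mulmxBr kb kbT subrr.
- by rewrite mulmxDr ab abT subrr.
Qed.

End Splitting.

Definition skew_mx B : 'M[F]_n := 2^-1 *: (B - B^T).

(** Matrix, in the dual basis, of the image of the skew part of B under B^-1. *)
Definition bivector B : 'M[F]_n := invmx B *m skew_mx B *m (invmx B)^T.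

(** The solution of the pointwise problem: [row_base] picks an arbitrary basis of
    the orthogonal complement of the image of the bivector, on which the result
    does not depend ([adaptedE]). *)
Definition adapted B G : 'M[F]_n :=
  invmx (dual_form G (row_base (kermx (G *m bivector B))) - bivector B).

Lemma skew_mx_tr B : (skew_mx B)^T = - skew_mx B.
Proof. by rewrite /skew_mx linearZ linearB /= trmxK -scalerN opprB. Qed.

Lemma bivector_tr B : (bivector B)^T = - bivector B.
Proof.
by rewrite /bivector 2!trmx_mul trmxK skew_mx_tr mulNmx mulmxN mulmxA.
Qed.

(** The bivector is the skew part of the transpose of B^-1; this is what lets B be
    changed through the symmetric part of its inverse only. *)
Lemma bivectorE B : B \in unitmx ->
  bivector B = 2^-1 *: ((invmx B)^T - invmx B).
Proof.
move=> uB; rewrite /bivector /skew_mx -scalemxAr -scalemxAl; congr (_ *: _).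
rewrite mulmxBr mulmxBl mulVmx// mul1mx; congr (_ - _).
by rewrite -mulmxA -trmx_mul mulVmx// trmx1 mulmx1.
Qed.

Lemma skew_mx_congr B J : skew_mx (J *m B *m J^T) = J *m skew_mx B *m J^T.
Proof.
rewrite /skew_mx -scalemxAr -scalemxAl; congr (_ *: _).
by rewrite mulmxBr mulmxBl 2!trmx_mul trmxK mulmxA.
Qed.

Lemma invmx_mul A B : A \in unitmx -> B \in unitmx ->
  invmx (A *m B) = invmx B *m invmx A.
Proof.
move=> uA uB; have uAB : A *m B \in unitmx by rewrite unitmx_mul uA.
rewrite -[RHS](mulmxK uAB) mulmxA mulmxKV// mulVmx//.
by rewrite mul1mx.
Qed.

Lemma bivector_congr B J : B \in unitmx -> J \in unitmx ->
  bivector (J *m B *m J^T) = (invmx J)^T *m bivector B *m invmx J.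
Proof.
move=> uB uJ; have uJT : J^T \in unitmx by rewrite unitmx_tr.
rewrite /bivector skew_mx_congr !invmx_mul ?unitmx_mul ?uJ//.
rewrite 2!trmx_mul -trmx_inv trmxK !mulmxA mulmxKV//.
by rewrite -(mulmxA _ J^T) -trmx_mul mulVmx// trmx1 mulmx1.
Qed.

Section Adapted.
Variables (B G : 'M[F]_n).
Hypotheses (uB : B \in unitmx) (Gp : posdef G).
Let K := row_base (kermx (G *m bivector B)).
Let fK : row_free K. Proof. exact: row_base_free. Qed.
Let KE : (K :=: kermx (G *m bivector B))%MS. Proof. exact: eq_row_base. Qed.
Let Q := dual_form G K.
Let Qs : Q^T = Q. Proof. exact: dual_form_sym. Qed.
Let QGP : Q *m G *m bivector B = 0.
Proof. by rewrite -mulmxA; apply/sub_kermxP; rewrite -KE dual_form_sub. Qed.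
Let QK (k : 'rV_n) : k *m G *m bivector B = 0 -> k *m G *m Q = k.
Proof.
move=> k0; apply: dual_formK => //; rewrite KE.
by apply/sub_kermxP; rewrite mulmxA.
Qed.

Lemma adapted_unit : adapted B G \in unitmx.
Proof. by rewrite unitmx_inv; exact: subr_skew_unit Gp (bivector_tr B) Qs QGP QK. Qed.

Lemma adapted_bivector : bivector (adapted B G) = bivector B.
Proof.
rewrite bivectorE ?adapted_unit// invmxK
   (trmx_subr_skew (bivector_tr B) Qs).
rewrite opprB [bivector B - _]addrC addrACA subrr add0r -mulr2n.
by rewrite -[bivector B *+ 2]scaler_nat scalerA mulVf ?scale1r ?pnatr_eq0.
Qed.

Lemma adapted_splitting (v : 'rV_n) : exists k d, [/\ v = k + d,
  k *m skew_mx (adapted B G) = 0 &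
  d *m (2^-1 *: (adapted B G + (adapted B G)^T)) = 0].
Proof.
have [k [d [-> k0 d0]]] := kernel_splitting Gp (bivector_tr B) Qs QGP QK v.
by exists k, d; split; rewrite // -scalemxAr ?k0 ?d0 scaler0.
Qed.

Lemma adaptedE m (W : 'M[F]_(m, n)) : row_free W ->
  (W :=: kermx (G *m bivector B))%MS ->
  adapted B G = invmx (dual_form G W - bivector B).
Proof.
move=> fW WE; rewrite /adapted (eqmx_dual_form (W' := W))//.
exact: eqmx_trans KE (eqmx_sym WE).
Qed.

Lemma rank_bivector : \rank (G *m bivector B) = \rank (skew_mx B).
Proof.
rewrite -[in LHS](mxrank_tr) trmx_mul bivector_tr mulNmx mxrank_opp.
rewrite mxrankMfree; last by rewrite row_free_unit unitmx_tr posdef_unit.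
rewrite /bivector mxrankMfree; last by rewrite row_free_unit unitmx_tr unitmx_inv.
by rewrite -mxrank_tr trmx_mul skew_mx_tr mulNmx mxrank_opp mxrankMfree//
  row_free_unit unitmx_tr unitmx_inv.
Qed.

End Adapted.

Lemma posdef_congr G J : posdef G -> J \in unitmx -> posdef (J *m G *m J^T).
Proof.
move=> [Gs Gp] uJ; split; first by rewrite 2!trmx_mul trmxK Gs mulmxA.
move=> v v0; have := Gp (v *m J); rewrite trmx_mul !mulmxA; apply.
by rewrite mulmx_free_eq0// row_free_unit.
Qed.

(** A change of coordinates maps a basis of the relevant kernel to another basis;
    independence of the basis turns the pointwise construction into a tensor. *)
Lemma adapted_congr B G J : B \in unitmx -> posdef G -> J \in unitmx ->
  adapted (J *m B *m J^T) (J *m G *m J^T) = J *m adapted B G *m J^T.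
Proof.
move=> uB Gp uJ; pose K := row_base (kermx (G *m bivector B)).
have uJT : J^T \in unitmx by rewrite unitmx_tr.
have uJV : invmx J \in unitmx by rewrite unitmx_inv.
have JVT : J^T *m (invmx J)^T = 1%:M by rewrite -trmx_mul mulVmx ?trmx1.
have GP : J *m G *m J^T *m bivector (J *m B *m J^T) =
    J *m (G *m bivector B) *m invmx J.
  by rewrite bivector_congr// !mulmxA -(mulmxA _ J^T) JVT mulmx1.
rewrite (@adaptedE _ _ _ _ (K *m invmx J)).
- rewrite dual_form_congr// bivector_congr// -mulmxBl -mulmxBr.
  have uD : dual_form G K - bivector B \in unitmx.
    by rewrite -unitmx_inv; exact: adapted_unit.
  rewrite !invmx_mul ?unitmx_mul ?unitmx_tr ?uJV//.
  by rewrite invmxK -trmx_inv invmxK -/K mulmxA.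
- exact: posdef_congr.
- by rewrite /row_free mxrankMfree ?row_free_unit//; exact: row_base_free.
- apply/eqmxP; rewrite -(geq_leqif (mxrank_leqif_eq _)).
    rewrite mxrankMfree ?row_free_unit// eq_row_base !mxrank_ker GP.
    rewrite mxrankMfree ?row_free_unit// eqmxMfull// row_full_unit//.
  have KGP : K *m (G *m bivector B) = 0.
    by apply/sub_kermxP; rewrite eq_row_base.
  apply/sub_kermxP; rewrite GP; move: KGP; move: (G *m bivector B) K => X.
  by move=> K KX; rewrite !mulmxA mulmxKV// KX mul0mx.
Qed.

(** A local frame for the kernel of a matrix of constant rank.  X completes A0 to an
    invertible matrix, with rank X = n - rank A0.  A row k of Ker A satisfies
    k (A + X) = k X, so that k = k X (A + X)^-1 as long as A + X is invertible:
    the rows of X (A + X)^-1 span Ker A, which has the dimension of their span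
    when A has the rank of A0. *)
Section LocalKernelFrame.
Variable (A0 : 'M[F]_n).
Let r := \rank A0.
Let X := col_ebase A0 *m copid_mx r *m row_ebase A0.

Lemma complement_unit : A0 + X \in unitmx.
Proof.
rewrite -{1}(mulmx_ebase A0) -mulmxDl -mulmxDr /copid_mx addrC subrK mulmx1.
by rewrite unitmx_mul col_ebase_unit row_ebase_unit.
Qed.

Definition kernel_frame A := row_base X *m invmx (A + X).

Lemma kernel_frameP A : \rank A = r -> A + X \in unitmx ->
  row_free (kernel_frame A) /\ (kernel_frame A :=: kermx A)%MS.
Proof.
move=> rA uZ; have uZV : row_free (invmx (A + X)) by rewrite row_free_unit unitmx_inv.
have rX : \rank X = (n - r)%N.
  rewrite mxrankMfree ?row_free_unit ?row_ebase_unit//.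
  rewrite eqmxMfull; last by rewrite row_full_unit col_ebase_unit.
  by rewrite rank_copid_mx// rank_leq_row.
have rK : \rank (kernel_frame A) = (n - r)%N.
  by rewrite mxrankMfree// eq_row_base.
split; first by rewrite /row_free rK rX.
apply: eqmx_sym; apply/eqmxP; rewrite -(geq_leqif (mxrank_leqif_eq _)) ?mxrank_ker ?rA ?rK//.
have -> : kermx A = kermx A *m X *m invmx (A + X).
  have -> : kermx A *m X = kermx A *m (A + X) by rewrite mulmxDr mulmx_ker add0r.
  by rewrite mulmxK.
by rewrite submxMr// (submx_trans (submxMl _ _))// eq_row_base.
Qed.

End LocalKernelFrame.
End AdaptedForms.

(** * Locally finite families of bump functions on a manifold *)

(** Otherwise the sets S such that K minus S meets finitely many members form a
    proper filter containing K.  A cluster point of it in K has a neighbourhood N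
    that meets finitely many members, so the complement of N is in the filter,
    which is absurd. *)
Lemma locally_finite_compact (T : topologicalType) (C : set (set T)) (K : set T) :
  locally_finite C -> compact K -> finite_set [set A | C A /\ A `&` K !=set0].
Proof.
move=> lfC cK; apply: contrapT => infK.
pose meet (S : set T) := [set A | C A /\ A `&` S !=set0].
pose F : set (set T) := [set S | finite_set (meet (K `\` S))].
have meetS S S' : S `<=` S' -> finite_set (meet S') -> finite_set (meet S).
  move=> SS'; apply: sub_finite_set => A [CA [x [Ax /SS' Sx]]].
  by split=> //; exists x.
have FF : ProperFilter F.
  split; first by rewrite /F /= setD0.
  split.
  - rewrite /F /= setDT; apply: sub_finite_set (@finite_set0 _) => A [_ [x []]] //.
  - move=> S S' FS FS'; rewrite /F /= setDIr.
    apply: (@sub_finite_set _ _ (meet (K `\` S) `|` meet (K `\` S'))).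
      move=> A [CA [x [Ax [KS|KS']]]]; [left|right]; split=> //; by exists x.
    by rewrite finite_setU.
  - by move=> S S' SS'; apply: meetS => x [Kx nS]; split=> // /SS'.
have FK : F K.
  rewrite /F /= setDv; apply: sub_finite_set (@finite_set0 _) => A [_ [x []]] //.
have [x [_ Fx]] := cK F FF FK.
have [N Nx fN] := lfC x.
have FN : F (~` N) by apply: meetS fN => y [_ /contrapT].
by have [y [nNy Ny]] := Fx _ _ FN Nx.
Qed.

Section ManifoldBumps.
Context {R : realType} {n : nat} (M : smoothManifold R n).
Implicit Types (p q : M) (i j : chart M).

Definition chart_image i : set 'rV[R]_n := chart_map i @` chart_dom i.

Lemma chart_dom_nbhs i p : chart_dom i p -> nbhs p (chart_dom i).
Proof. by move=> ip; apply: open_nbhs_nbhs; split => //; exact: chart_dom_open. Qed.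

Lemma chart_invK i x : chart_image i x -> chart_map i (chart_inv i x) = x.
Proof. by move=> [q iq <-]; rewrite chart_mapK. Qed.

Lemma chart_inv_dom i x : chart_image i x -> chart_dom i (chart_inv i x).
Proof. by move=> [q iq <-]; rewrite chart_mapK. Qed.

Lemma chart_image_nbhs i x : chart_image i x -> nbhs x (chart_image i).
Proof. by move=> ix; apply: open_nbhs_nbhs; split => //; exact: chart_image_open. Qed.

Lemma chart_inv_nbhs i x (W : set M) : chart_image i x ->
  nbhs (chart_inv i x) W -> nbhs x (chart_image i `&` (chart_inv i @^-1` W)).
Proof.
move=> ix Wx; apply: filterI; first exact: chart_image_nbhs.
exact: chart_inv_continuous ix _ Wx.
Qed.

Definition chart_overlap i j : set 'rV[R]_n :=
  chart_map i @` (chart_dom i `&` chart_dom j).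

Lemma chart_overlap_open i j : open (chart_overlap i j).
Proof.
rewrite openE => _ [q [iq jq] <-].
have iiq : chart_image i (chart_map i q) by exists q.
have jn : nbhs (chart_inv i (chart_map i q)) (chart_dom j).
  by rewrite chart_mapK//; exact: chart_dom_nbhs.
apply: filterS (chart_inv_nbhs iiq jn) => y [iy /= jy].
by exists (chart_inv i y); [split => //; exact: chart_inv_dom|exact: chart_invK].
Qed.

Definition smooth_fun (f : M -> R^o) : Prop :=
  forall j, smooth_on (chart_image j) (f \o chart_inv j).

Definition chart_ball i (c : 'rV[R]_n) (r : R) : set M :=
  chart_inv i @` [set x | `|c - x| <= r].

(** The closed ball for the sup norm lies in the range of the chart, hence its
    pull-back [chart_ball] is compact, and closed since the space is Hausdorff. *)
Definition in_chart i (c : 'rV[R]_n) (r : R) : Prop :=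
  0 < r /\ [set x | `|c - x| <= r] `<=` chart_image i.

Definition chart_bump i (c : 'rV[R]_n) (r : R) (q : M) : R^o :=
  if `[< chart_dom i q >] then ball_bump c r (chart_map i q) else 0.

Lemma chart_bump_ge0 i c r q : 0 <= chart_bump i c r q.
Proof. by rewrite /chart_bump; case: asboolP => // _; exact: ball_bump_ge0. Qed.

Section OneBump.
Variables (i : chart M) (c : 'rV[R]_n) (r : R).
Hypothesis icr : in_chart i c r.

Lemma chart_ball_sub : chart_ball i c r `<=` chart_dom i.
Proof. by move=> _ [x cx <-]; apply: chart_inv_dom; exact: icr.2. Qed.

Lemma chart_ball_compact : compact (chart_ball i c r).
Proof.
apply: continuous_compact; last by apply: compact_closed_ball; exact: icr.1.
rewrite continuous_subspace_in => x; rewrite inE => cx.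
apply: continuous_subspaceT_for => //; apply: chart_inv_continuous; exact: icr.2.
Qed.

Lemma chart_ball_closed : closed (chart_ball i c r).
Proof. exact: compact_closed (@space_hausdorff _ _ M) chart_ball_compact. Qed.

Lemma chart_bump_support q : chart_bump i c r q != 0 -> chart_ball i c r q.
Proof.
rewrite /chart_bump; case: asboolP => [iq|_]; last by rewrite eqxx.
move=> b0; exists (chart_map i q); last exact: chart_mapK.
by apply: ball_bump_support => //; exact: icr.1.
Qed.

Lemma chart_bump_open : open [set q | 0 < chart_bump i c r q].
Proof.
rewrite openE => q /= q0.
have iq : chart_dom i q.
  by apply: chart_ball_sub; apply: chart_bump_support; rewrite gt_eqF.
have H : nbhs q ((ball_bump c r \o chart_map i) @^-1` [set y : R^o | 0 < y]).
  have cb : {for q, continuous (ball_bump c r \o chart_map i)}.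
    apply: continuous_comp; first exact: chart_map_continuous.
    exact: ball_bump_smooth 0 _ I.
  apply: cb; apply: open_nbhs_nbhs; split; first exact: open_gt.
  by move: q0; rewrite /chart_bump asboolT.
apply: filterS2 (chart_dom_nbhs iq) H => q' iq' /=.
by rewrite /chart_bump asboolT.
Qed.

(** Near a point of the domain of the chart i, the bump is a smooth function
    composed with a transition map.  At any other point it vanishes on a
    neighbourhood, the complement of the closed set [chart_ball]. *)
Lemma chart_bump_smooth : smooth_fun (chart_bump i c r).
Proof.
move=> j k; apply: Ck_on_pointwise => x jx.
pose p := chart_inv j x; have jp : chart_dom j p := chart_inv_dom jx.
have cj : {for x, continuous (chart_inv j)} by exact: chart_inv_continuous.
have [ip|nip] := pselect (chart_dom i p).
  pose U := chart_overlap j i.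
  have Ux : U x by exists p; rewrite ?chart_invK.
  have oU : open U by exact: chart_overlap_open.
  apply: (@Ck_on_subset _ _ _ _ U); first by move=> _ ->.
  apply: (Ck_on_eq oU _ (Ck_on_comp oU (fun _ _ => I) (ball_bump_smooth c r k)
    (transition_smooth j i k))).
  by move=> _ [q [jq iq] <-]; rewrite /= /chart_bump chart_mapK// asboolT.
pose U := chart_image j `&` (chart_inv j @^-1` ~` chart_ball i c r).
have oU : open U.
  rewrite openE => y [jy /= niy]; apply: chart_inv_nbhs => //.
  apply: open_nbhs_nbhs; split => //.
  by apply: closed_openC; exact: chart_ball_closed.
have Ux : U x by split => // /chart_ball_sub.
apply: (@Ck_on_subset _ _ _ _ U); first by move=> _ ->.
apply: (Ck_on_eq oU _ (Ck_on_cst k U (0 : R^o))) => y [_ /= niy].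
by apply/esym/eqP; apply: contra_notT niy => /chart_bump_support.
Qed.

End OneBump.

Lemma chart_bump_exists p (W : set M) : nbhs p W -> exists i c r,
  [/\ in_chart i c r, chart_ball i c r `<=` W & 0 < chart_bump i c r p].
Proof.
move=> Wp; have [i ip] := cid (chart_dom_cover p); pose c := chart_map i p.
have ic : chart_image i c by exists p.
have nW : nbhs c (chart_image i `&` (chart_inv i @^-1` W)).
  by apply: chart_inv_nbhs => //; rewrite chart_mapK.
have [e eW] := nbhs_ex nW.
have r0 : 0 < e%:num / 2 by rewrite divr_gt0.
have sub y : `|c - y| <= e%:num / 2 -> (chart_image i `&` (chart_inv i @^-1` W)) y.
  move=> cy; apply: eW; rewrite -ball_normE /=; apply: le_lt_trans cy _.
  by rewrite ltr_pdivrMr// ltr_pMr// ltr1n.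
exists i, c, (e%:num / 2); split.
- by split => // y /sub[].
- by move=> _ [y /sub[_ +] <-].
- by rewrite /chart_bump asboolT//; exact: ball_bump_center.
Qed.

Record bump_data := BumpData {
  bchart : chart M; bcenter : 'rV[R]_n; bradius : R;
  bump_in_chart : in_chart bchart bcenter bradius }.

Definition bfun (b : bump_data) := chart_bump (bchart b) (bcenter b) (bradius b).
Definition bball (b : bump_data) := chart_ball (bchart b) (bcenter b) (bradius b).

Lemma bump_data_exists p (W : set M) : nbhs p W ->
  exists b, bball b `<=` W /\ 0 < bfun b p.
Proof.
move=> /chart_bump_exists[i [c [r [icr sW b0]]]].
by exists (BumpData icr).
Qed.

HB.instance Definition _ := gen_eqMixin bump_data.
HB.instance Definition _ := gen_choiceMixin bump_data.

(** Two refinements are made.  The first, C1, consists of relatively compact sets;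
    each point p gets a bump supported in a member of C1 and positive at p.  The
    second, C3, refines the cover by the positivity sets of these bumps, and each
    non-empty D in C3 selects one bump positive on D.  A point has a neighbourhood
    meeting finitely many members of C1, and a member of C1 contains only
    finitely many non-empty members of C3, by compactness: the selected bumps are
    locally finite. *)
Lemma locally_finite_bumps : exists I : set bump_data,
  (forall p, exists2 b, I b & 0 < bfun b p) /\
  (forall p, exists2 N, nbhs p N &
     finite_set [set b | I b /\ exists2 q, N q & bfun b q != 0]).
Proof.
have pos (b : bump_data) : open [set q | 0 < bfun b q].
  by apply: chart_bump_open; exact: bump_in_chart.
have posK (b : bump_data) : [set q | 0 < bfun b q] `<=` bball b.
  move=> q /= q0; apply: chart_bump_support; first exact: bump_in_chart.
  by rewrite gt_eqF.
pose C0 : set (set M) := [set A | exists b, A = [set q | 0 < bfun b q]].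
have [|C1 [[oC1 cC1] lfC1 rC1]] := @space_paracompact _ _ M C0.
  split; first by move=> _ [b ->]; exact: pos.
  apply/seteqP; split => // p _.
  have [b [_ bp]] := bump_data_exists (p := p) (W := setT) filterT.
  by exists [set q | 0 < bfun b q] => //; exists b.
have K1 A : C1 A -> exists2 K, compact K & A `<=` K.
  move=> /rC1[_ [b ->] Ab]; exists (bball b); last exact: subset_trans Ab (posK b).
  by apply: chart_ball_compact; exact: bump_in_chart.
have H p : exists b, exists A, [/\ C1 A, bball b `<=` A & 0 < bfun b p].
  have : [set: M] p by []. rewrite -cC1 => -[A C1A Ap].
  have [|b [bA bp]] := bump_data_exists (p := p) (W := A).
    by apply: open_nbhs_nbhs; split => //; exact: oC1.
  by exists b, A.
have [b0 Hb0] := choice H.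
pose C2 : set (set M) := [set A | exists p, A = [set q | 0 < bfun (b0 p) q]].
have [|C3 [[oC3 cC3] lfC3 rC3]] := @space_paracompact _ _ M C2.
  split; first by move=> _ [p ->]; exact: pos.
  apply/seteqP; split => // p _; exists [set q | 0 < bfun (b0 p) q].
    by exists p.
  by have [A []] := Hb0 p.
pose I := C3 `&` [set D | D !=set0].
have HI D : exists ob, I D -> exists b A, [/\ ob = Some b, C1 A,
    bball b `<=` A & D `<=` [set q | 0 < bfun b q]].
  have [[C3D _]|nI] := pselect (I D); last by exists None.
  have [_ [p ->] Dp] := rC3 D C3D; exists (Some (b0 p)) => _.
  by have [A [C1A bA _]] := Hb0 p; exists (b0 p), A.
have [f Hf] := choice HI.
exists [set b | exists2 D, I D & f D = Some b]; split => [p|p].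
  have : [set: M] p by []. rewrite -cC3 => -[D C3D Dp].
  have ID : I D by split => //; exists p.
  have [b [A [fD _ _ Db]]] := Hf D ID.
  by exists b; [exists D|exact: Db].
have [N Np fN] := lfC1 p; exists N => //.
have fin : finite_set (\bigcup_(A in [set A | C1 A /\ A `&` N !=set0])
    [set D | C3 D /\ D !=set0 /\ D `<=` A]).
  apply: bigcup_finite => // A [C1A _].
  have [K cK AK] := K1 A C1A.
  apply: sub_finite_set (locally_finite_compact lfC3 cK) => D [C3D [[q Dq] DA]].
  by split => //; exists q; split => //; apply: AK; exact: DA.
have Si B : {in Some @^-1` B &, injective (@Some bump_data)} by move=> x y _ _ [].
apply: sub_finite_set (finite_preimage (Si _) (finite_image f fin)) => b.
move=> [[D ID fD] [q Nq bq]]; have [b' [A [fD' C1A bA DA]]] := Hf D ID.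
exists D => //; move: fD'; rewrite fD => -[bb]; subst b'.
exists A; first split => //.
  exists q; split => //; apply: bA.
  by apply: chart_bump_support => //; exact: bump_in_chart.
split; first exact: ID.1.
split; first exact: ID.2.
by apply: subset_trans bA; apply: subset_trans DA (posK _).
Qed.

End ManifoldBumps.

(** * Smooth dependence of the adapted form, and Jacobians of the transition maps *)

Lemma smooth_mx_local (R : realType) (V : normedModType R) m n (U : set V)
    (A : V -> 'M[R]_(m, n)) :
  (forall x, U x -> exists U', [/\ open U', U' x & smooth_mx U' A]) ->
  smooth_mx U A.
Proof.
move=> H i j k; apply: Ck_on_pointwise => x /H[U' [_ U'x sA]].
by apply: Ck_on_subset (sA i j k) => _ ->.
Qed.

(** Only the basis of Ker(G Pi) in the definition of [adapted] is not visibly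
    smooth.  The rank of G Pi is constant, so near each point that basis can be
    replaced by the smooth frame [kernel_frame]. *)
Lemma smooth_adapted (R : realType) (V : normedModType R) n r (U : set V)
    (B G : V -> 'M[R]_n) : open U ->
  smooth_mx U B -> smooth_mx U G ->
  (forall x, U x -> B x \in unitmx) -> (forall x, U x -> posdef (G x)) ->
  (forall x, U x -> \rank (skew_mx (B x)) = r) ->
  smooth_mx U (fun x => adapted (B x) (G x)).
Proof.
move=> oU sB sG uB pG rB.
have sBV : smooth_mx U (fun x => invmx (B x)) by exact: smooth_mx_inv.
have sP : smooth_mx U (fun x => bivector (B x)).
  have s2 : smooth_on U (fun=> 2^-1 : R^o) by move=> k; exact: Ck_on_cst.
  have sPE : smooth_mx U (fun x => 2^-1 *: ((invmx (B x))^T - invmx (B x))).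
    apply: (smooth_mx_scale oU s2); apply: smooth_mx_add => //.
      exact: smooth_mx_tr.
    exact: smooth_mx_opp.
  by apply: (smooth_mx_eq oU _ sPE) => x Ux; rewrite bivectorE ?uB.
pose A x := G x *m bivector (B x).
have sA : smooth_mx U A by exact: smooth_mx_mul.
have rA x : U x -> \rank (A x) = r.
  by move=> Ux; rewrite rank_bivector ?rB//; [exact: uB|exact: pG].
apply: smooth_mx_local => x0 Ux0.
pose X := col_ebase (A x0) *m copid_mx (\rank (A x0)) *m row_ebase (A x0).
have sZ : smooth_mx U (fun x => A x + X).
  by apply: smooth_mx_add => //; exact: smooth_mx_cst.
pose U' := U `&` [set x | A x + X \in unitmx].
have oU' : open U' by exact: open_unitmx.
have sU' : U' `<=` U by move=> x [].
have sW : smooth_mx U' (fun x => kernel_frame (A x0) (A x)).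
  apply: smooth_mx_mul => //; first exact: smooth_mx_cst.
  apply: smooth_mx_inv => //; first by move=> x [].
  exact: smooth_mx_subset sZ.
have WP x : U' x -> row_free (kernel_frame (A x0) (A x)) /\
    (kernel_frame (A x0) (A x) :=: kermx (A x))%MS.
  by move=> [Ux uZ]; apply: kernel_frameP => //; rewrite !rA.
exists U'; split => //.
  by split => //=; exact: complement_unit.
have sG' := smooth_mx_subset sU' sG; have sP' := smooth_mx_subset sU' sP.
have sD : smooth_mx U' (fun x => dual_form (G x) (kernel_frame (A x0) (A x))).
  apply: smooth_mx_mul => //; apply: smooth_mx_mul => //.
    exact: smooth_mx_tr.
  apply: smooth_mx_inv => //.
    by move=> x U'x; apply: posdef_gram_unit; [apply: pG; exact: sU'|exact: (WP x U'x).1].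
  apply: smooth_mx_mul => //; last exact: smooth_mx_tr.
  exact: smooth_mx_mul.
have aE x : U' x -> adapted (B x) (G x) =
    invmx (dual_form (G x) (kernel_frame (A x0) (A x)) - bivector (B x)).
  move=> U'x; have [fW WE] := WP x U'x; have Ux := sU' x U'x.
  by apply: adaptedE => //; exact: pG.
apply: (smooth_mx_eq oU' (fun x U'x => esym (aE x U'x))).
apply: smooth_mx_inv => //.
  move=> x U'x; have Ux := sU' x U'x; rewrite -unitmx_inv -aE//.
  by apply: adapted_unit; exact: pG.
apply: smooth_mx_add => //; exact: smooth_mx_opp.
Qed.

Lemma mulmx_ext (F : fieldType) m n (A B : 'M[F]_(m, n)) :
  (forall u : 'rV_m, u *m A = u *m B) -> A = B.
Proof. by move=> AB; apply/row_matrixP => i; rewrite !rowE AB. Qed.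

Section Jacobians.
Context {R : realType} {n : nat} {M : smoothManifold R n}.
Implicit Types (p : M) (i j k : chart M).

(** The Jacobian matrix enters only through its action on row vectors, so it is
    introduced by that property alone. *)
Fact jac_subproof : {J : chart M -> chart M -> M -> 'M[R]_n |
  forall i j p (w : 'rV[R]_n),
    w *m J i j p = 'd (transition i j) (chart_map i p) w}.
Proof.
exists (fun i j p => jacobian (transition i j) (chart_map i p)) => i j p w.
by rewrite /jacobian mul_rV_lin1.
Qed.

Definition jac i j p : 'M[R]_n := sval jac_subproof i j p.

Lemma mul_jac i j p (w : 'rV[R]_n) :
  w *m jac i j p = 'd (transition i j) (chart_map i p) w.
Proof. exact: (svalP jac_subproof). Qed.

Lemma component_jac i j p (v : tangent p) : chart_dom i p -> chart_dom j p ->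
  component v j = component v i *m jac i j p.
Proof. by move=> ip jp; rewrite mul_jac; exact: componentE. Qed.

Lemma jac_cocycle i j k p : chart_dom i p -> chart_dom j p -> chart_dom k p ->
  jac i j p *m jac j k p = jac i k p.
Proof.
move=> ip jp kp; apply: mulmx_ext => u.
rewrite (mulmxA u).
rewrite (mul_jac i j p u).
rewrite (mul_jac j k).
rewrite (mul_jac i k).
exact: (transition_cocycle u ip jp kp).
Qed.

Lemma jac_id i p : chart_dom i p -> jac i i p = 1%:M.
Proof.
move=> ip; apply: mulmx_ext => u; rewrite (mul_jac i i p u) mulmx1.
exact: transition_id.
Qed.

Lemma jac_unit i j p : chart_dom i p -> chart_dom j p -> jac i j p \in unitmx.
Proof.
move=> ip jp; have /mulmx1_unit[] // : jac i j p *m jac j i p = 1%:M.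
by rewrite jac_cocycle// jac_id.
Qed.

Lemma jac_smooth i j :
  smooth_mx (chart_overlap i j) (fun x => jac i j (chart_inv i x)).
Proof.
move=> a b k; have oU := @chart_overlap_open _ _ M i j.
have [dt Dt] := transition_smooth i j k.+1.
apply: (Ck_on_eq oU _ (Ck_on_coord 0 b oU (Dt (delta_mx 0 a)))) => x Ux.
rewrite deriveE; last exact: dt.
have [p [ip jp] px] := Ux.
have xE : chart_map i (chart_inv i x) = x by rewrite -px chart_mapK.
by rewrite -{1 2}xE -mul_jac -rowE mxE.
Qed.

End Jacobians.

(** * Tensors as matrices in a chart *)

Section TensorMatrices.
Context {R : realType} {n : nat} {M : smoothManifold R n}.
Implicit Types (p : M) (i j k : chart M).

Definition component_in p i (v : tangent p) : 'rV[R]_n := component v i.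

Fact component_in_linear p i : linear (@component_in p i).
Proof. by []. Qed.

HB.instance Definition _ p i :=
  GRing.isLinear.Build R (tangent p) 'rV[R]_n _ (@component_in p i)
    (@component_in_linear p i).

Lemma component_lin p i (a : R) (u v : tangent p) :
  component (a *: u + v) i = a *: component u i + component v i.
Proof. by []. Qed.

Lemma componentK p i (v : tangent p) : chart_dom i p ->
  chart_vector i p (component v i) = v.
Proof. by move=> ip; apply: (component_inj ip); exact: chart_vectorK. Qed.

Definition coord_vector i p (a : 'I_n) : tangent p :=
  chart_vector i p (delta_mx 0 a).

Lemma coord_vector_sum p i (v : tangent p) : chart_dom i p ->
  v = \sum_a component v i 0 a *: coord_vector i p a.
Proof.
move=> ip; apply: (component_inj ip).
rewrite -[RHS]/(component_in i _) linear_sum.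
rewrite [LHS]row_sum_delta; apply: eq_bigr => a _; rewrite linearZ /=.
by rewrite -[X in _ *: X = _](chart_vectorK _ ip).
Qed.

Definition tensor_mx i p (T : tensor2 p) : 'M[R]_n :=
  \matrix_(a, b) T (coord_vector i p a) (coord_vector i p b).

Lemma tensor_mxE i p (T : tensor2 p) (u v : tangent p) : chart_dom i p ->
  T u v = (component u i *m tensor_mx i T *m (component v i)^T) 0 0.
Proof.
move=> ip; rewrite {1}(coord_vector_sum u ip) {1}(coord_vector_sum v ip).
rewrite mxE linear_sum; apply: eq_bigr => b _ /=.
rewrite linear_sum sum_lfunE mxE mulr_suml /=; apply: eq_bigr => a _.
by rewrite !linearZ /= scale_lfunE /= !mxE /GRing.scale /= mulrC.
Qed.

Lemma mx_entryE m (A : 'M[R]_m) a b :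
  A a b = ((delta_mx 0 a : 'rV_m) *m A *m (delta_mx 0 b : 'rV_m)^T) 0 0.
Proof. by rewrite -rowE trmx_delta -colE !mxE. Qed.

Lemma tensor_mx_eq p i (T : tensor2 p) (A : 'M[R]_n) : chart_dom i p ->
  (forall u v : 'rV[R]_n,
    T (chart_vector i p u) (chart_vector i p v) = (u *m A *m v^T) 0 0) ->
  tensor_mx i T = A.
Proof.
by move=> ip TA; apply/matrixP => a b; rewrite mxE /coord_vector TA -mx_entryE.
Qed.

Lemma tensor_mx_congr p i j (T : tensor2 p) : chart_dom i p -> chart_dom j p ->
  tensor_mx i T = jac i j p *m tensor_mx j T *m (jac i j p)^T.
Proof.
move=> ip jp; apply: tensor_mx_eq => // u v; rewrite (tensor_mxE T _ _ jp).
rewrite !(component_jac _ ip jp) !chart_vectorK// trmx_mul.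
by move: (jac i j p) => J; rewrite !mulmxA.
Qed.

Lemma tensor_mx_skew p i (T : tensor2 p) : tensor_mx i (skew_part T) = skew_mx (tensor_mx i T).
Proof. by apply/matrixP => a b; rewrite !mxE skew_partE. Qed.

Lemma tensor_mx_sym p i (T : tensor2 p) :
  tensor_mx i (sym_part T) = 2^-1 *: (tensor_mx i T + (tensor_mx i T)^T).
Proof. by apply/matrixP => a b; rewrite !mxE sym_partE. Qed.

Section TensorOfMatrix.
Variables (p : M) (i : chart M) (A : 'M[R]_n).

Definition mx_form (u v : tangent p) : R^o :=
  (component u i *m A *m (component v i)^T) 0 0.

Fact mx_form_linear u : linear (mx_form u).
Proof.
move=> a v w; rewrite /mx_form component_lin.
by rewrite linearP mulmxDr -scalemxAr !mxE.
Qed.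

HB.instance Definition _ u :=
  GRing.isLinear.Build R (tangent p) R^o _ (mx_form u) (mx_form_linear u).

Definition mx_form_row (u : tangent p) : cotangent p := linfun (mx_form u).

Fact mx_form_row_linear : linear mx_form_row.
Proof.
move=> a u v; apply/lfunP => w.
rewrite add_lfunE scale_lfunE !lfunE /= /mx_form.
by rewrite component_lin !mulmxDl -!scalemxAl !mxE.
Qed.

HB.instance Definition _ :=
  GRing.isLinear.Build R (tangent p) (cotangent p) _ mx_form_row mx_form_row_linear.

Definition tensor_of_mx : tensor2 p := linfun mx_form_row.

Lemma tensor_of_mxE u v : tensor_of_mx u v = mx_form u v.
Proof. by rewrite lfunE /= lfunE. Qed.

Lemma tensor_of_mxK : chart_dom i p -> tensor_mx i tensor_of_mx = A.
Proof.
move=> ip; apply: tensor_mx_eq => // u v.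
by rewrite tensor_of_mxE /mx_form !chart_vectorK.
Qed.

End TensorOfMatrix.

Lemma tensor_eq0P p i (T : tensor2 p) u : chart_dom i p ->
  T u = 0 <-> component u i *m tensor_mx i T = 0.
Proof.
move=> ip; split=> [Tu|uT].
  apply/matrixP => a b; rewrite ord1 [RHS]mxE.
  have := tensor_mxE T u (coord_vector i p b) ip.
  rewrite Tu zero_lfunE chart_vectorK// trmx_delta -colE => /esym.
  by rewrite !mxE.
by apply/lfunP => v; rewrite (tensor_mxE _ _ _ ip) uT mul0mx mxE zero_lfunE.
Qed.

Lemma nondegenerate_unit p i (T : tensor2 p) : chart_dom i p ->
  nondegenerate_tensor T -> tensor_mx i T \in unitmx.
Proof.
move=> ip /bij_inj injT; rewrite -row_free_unit -kermx_eq0.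
apply/eqP/row_matrixP => a; rewrite row0; set k := row a _.
have k0 : k *m tensor_mx i T = 0 by rewrite -row_mul mulmx_ker row0.
have : T (chart_vector i p k) = 0.
  by apply/(tensor_eq0P _ _ ip); rewrite chart_vectorK.
rewrite -[RHS](linear0 T) => /injT k'0.
by rewrite -[LHS](chart_vectorK k ip) k'0.
Qed.

Lemma unit_nondegenerate p i (T : tensor2 p) : chart_dom i p ->
  tensor_mx i T \in unitmx -> nondegenerate_tensor T.
Proof.
move=> ip uT.
pose g (al : cotangent p) : tangent p :=
  chart_vector i p ((\row_b al (coord_vector i p b)) *m invmx (tensor_mx i T)).
have gK : cancel g T.
  move=> al; apply/lfunP => v; rewrite (tensor_mxE _ _ _ ip) chart_vectorK//.
  rewrite mulmxKV// mxE {2}(coord_vector_sum v ip) linear_sum.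
  by apply: eq_bigr => b _; rewrite !mxE linearZ /= /GRing.scale /= mulrC.
have injT : injective T.
  move=> u v Tuv; apply/eqP; rewrite -subr_eq0; apply/eqP.
  have : T (u - v) = 0 by rewrite linearB /= Tuv subrr.
  move=> /(tensor_eq0P _ _ ip) /(congr1 (mulmx^~ (invmx (tensor_mx i T)))).
  rewrite mulmxK// mul0mx => uv0; apply: (component_inj ip).
  by rewrite uv0.
by exists g => // u; apply: injT; rewrite gK.
Qed.

Fact chart_vector_linear p i : chart_dom i p -> linear (chart_vector i p).
Proof.
move=> ip a u v; apply: (component_inj ip); rewrite chart_vectorK//.
by rewrite component_lin !chart_vectorK.
Qed.

Lemma leq_dim_inj m (W : vectType R) (U : {vspace W}) (f : 'rV[R]_m -> W) :
  linear f -> (forall w, f w = 0 -> w = 0) -> (forall w, f w \in U) ->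
  (m <= \dim U)%N.
Proof.
move=> lf f0 fU; pose L := GRing.isLinear.Build R 'rV[R]_m W _ f lf.
pose F : {linear 'rV[R]_m -> W} := HB.pack f L.
have FE w : linfun F w = f w by rewrite lfunE.
have kF : lker (linfun F) == 0%VS.
  by apply/lker0P/raddf_inj => w /=; rewrite FE; exact: f0.
have <- : \dim (limg (linfun F)) = m.
  by rewrite limg_dim_eq ?(eqP kF) ?capv0// dimvf /dim /= mul1n.
apply/dimvS/subvP => _ /memv_imgP[w _ ->]; rewrite FE; exact: fU.
Qed.

(** Rows of A = [tensor_mx i T] that form a basis embed R^rank(A) in the image of T,
    and a basis of Ker A embeds its coordinate space in the kernel of T.  Both
    inequalities are equalities, as the dimensions of kernel and image sum to n. *)
Lemma tensor_rank_mx p i (T : tensor2 p) : chart_dom i p ->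
  \rank (tensor_mx i T) = tensor_rank T.
Proof.
move=> ip; pose A := tensor_mx i T.
have [S SA] : exists S, row_base A = S *m A.
  by apply/submxP; rewrite eq_row_base.
have rank_le : (\rank A <= tensor_rank T)%N.
  apply: (leq_dim_inj (f := fun w => T (chart_vector i p (w *m S)))).
  - by move=> a u v; rewrite mulmxDl -scalemxAl (chart_vector_linear ip) linearP.
  - move=> w /(tensor_eq0P _ _ ip); rewrite chart_vectorK// -mulmxA -SA => /eqP.
    by rewrite mulmx_free_eq0 ?row_base_free// => /eqP.
  - by move=> w; rewrite memv_img// memvf.
have ker_le : (\rank (kermx A) <= \dim (lker T))%N.
  apply: (leq_dim_inj (f := fun w => chart_vector i p (w *m row_base (kermx A)))).
  - by move=> a u v; rewrite mulmxDl -scalemxAl (chart_vector_linear ip).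
  - move=> w /(congr1 (fun v => component v i)); rewrite chart_vectorK// => /eqP.
    by rewrite mulmx_free_eq0 ?row_base_free// => /eqP.
  - move=> w; rewrite memv_ker; apply/eqP/(tensor_eq0P _ _ ip).
    rewrite chart_vectorK//; apply/sub_kermxP.
    by rewrite (submx_trans (submxMl _ _))// eq_row_base.
have := limg_ker_dim T fullv; rewrite capfv dimvf /dim /= -/(tensor_rank T).
move=> kT; apply/eqP; rewrite eqn_leq rank_le /=.
by move: ker_le; rewrite mxrank_ker leq_subLR -[X in (X <= _)%N]kT addnC leq_add2r.
Qed.

Lemma Lambda2_inv_mx p i (T : tensor2 p) (a b : cotangent p) :
  chart_dom i p -> nondegenerate_tensor T ->
  Lambda2_inv T (skew_part T) a b =
  (\row_c a (coord_vector i p c) *m bivector (tensor_mx i T)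
     *m (\row_c b (coord_vector i p c))^T) 0 0.
Proof.
move=> ip ndT; have uT := nondegenerate_unit ip ndT.
have TV (al : cotangent p) : component ((T^-1)%VF al) i =
    \row_c al (coord_vector i p c) *m invmx (tensor_mx i T).
  apply: (can_inj (mulmxK uT)); rewrite mulmxKV//.
  have Tal : T ((T^-1)%VF al) = al.
    apply: limg_lfunVK; have [g _ gK] := ndT.
    by rewrite -(gK al) memv_img// memvf.
  apply/matrixP => z c; rewrite ord1 [RHS]mxE -[in RHS]Tal (tensor_mxE _ _ _ ip).
  by rewrite chart_vectorK// trmx_delta -colE !mxE.
rewrite /Lambda2_inv (tensor_mxE _ _ _ ip) !TV tensor_mx_skew /bivector trmx_mul.
by rewrite !mulmxA.
Qed.

End TensorMatrices.

(** * A Riemannian metric, and the theorem *)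

Section RiemannianMetric.
Context {R : realType} {n : nat} {M : smoothManifold R n}.
Implicit Types (p : M) (i j k : chart M) (b : bump_data M).

(** The Euclidean metric of the chart of b, weighted by the bump and expressed in
    the chart i; outside the chart of b the weight is 0. *)
Definition chart_metric i b p : 'M[R]_n :=
  bfun b p *: (jac i (bchart b) p *m (jac i (bchart b) p)^T).

Lemma bfun_ge0 b p : 0 <= bfun b p.
Proof. exact: chart_bump_ge0. Qed.

Lemma bfun_dom b p : bfun b p != 0 -> chart_dom (bchart b) p.
Proof.
move=> bp; apply: chart_ball_sub (bump_in_chart b) _ _.
exact: chart_bump_support (bump_in_chart b) _ bp.
Qed.

Lemma chart_metric_congr i j b p : chart_dom i p -> chart_dom j p ->
  chart_metric i b p = jac i j p *m chart_metric j b p *m (jac i j p)^T.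
Proof.
move=> ip jp; rewrite /chart_metric -scalemxAr -scalemxAl.
have [->|/bfun_dom kp] := eqVneq (bfun b p) 0; first by rewrite !scale0r.
by rewrite -(jac_cocycle ip jp kp) trmx_mul !mulmxA.
Qed.

Lemma chart_metric_smooth i b :
  smooth_mx (chart_image i) (fun x => chart_metric i b (chart_inv i x)).
Proof.
apply: smooth_mx_local => x ix; set k := bchart b.
have sb : smooth_fun (bfun b) := chart_bump_smooth (bump_in_chart b).
have [kx|nkx] := pselect (chart_dom k (chart_inv i x)).
  have oU := @chart_overlap_open _ _ M i k.
  exists (chart_overlap i k); split => //.
    exists (chart_inv i x); last exact: chart_invK.
    by split => //; exact: chart_inv_dom.
  apply: (smooth_mx_scale oU (c := fun x => bfun b (chart_inv i x))).
    move=> m; apply: Ck_on_subset (sb i m) => _ [q [iq _] <-]; by exists q.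
  apply: smooth_mx_mul => //; last apply: smooth_mx_tr => //.
    exact: jac_smooth.
  exact: jac_smooth.
pose U := chart_image i `&` (chart_inv i @^-1` ~` bball b).
have oU : open U.
  rewrite openE => y [iy /= nby]; apply: chart_inv_nbhs => //.
  apply: open_nbhs_nbhs; split => //.
  apply: closed_openC; exact: chart_ball_closed (bump_in_chart b).
exists U; split => //.
  by split => // /(chart_ball_sub (bump_in_chart b)).
apply: (smooth_mx_eq oU _ (smooth_mx_cst U 0)) => y [_ /= nby].
rewrite /chart_metric (_ : bfun b _ = 0) ?scale0r//.
by apply/eqP; apply: contra_notT nby; exact: chart_bump_support (bump_in_chart b) _.
Qed.

Lemma gram_mulmx (v : 'rV[R]_n) (J : 'M[R]_n) :
  v *m (J *m J^T) *m v^T = v *m J *m (v *m J)^T.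
Proof. by rewrite trmx_mul !mulmxA. Qed.

Lemma chart_metric_form i b p (v : 'rV[R]_n) :
  0 <= (v *m chart_metric i b p *m v^T) 0 0.
Proof.
rewrite /chart_metric -scalemxAr -scalemxAl mxE mulr_ge0 ?bfun_ge0//.
rewrite gram_mulmx; set w := v *m _.
by rewrite mxE sumr_ge0// => a _; rewrite [_^T _ _]mxE -expr2 sqr_ge0.
Qed.

Lemma chart_metric_form_gt0 i b p (v : 'rV[R]_n) : chart_dom i p ->
  0 < bfun b p -> v != 0 -> 0 < (v *m chart_metric i b p *m v^T) 0 0.
Proof.
move=> ip bp v0; have kp : chart_dom (bchart b) p by apply: bfun_dom; rewrite gt_eqF.
rewrite /chart_metric -scalemxAr -scalemxAl mxE mulr_gt0//.
rewrite gram_mulmx; set w := v *m _.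
have w0 : w != 0.
  by rewrite mulmx_free_eq0// row_free_unit jac_unit.
have /rV0Pn[a wa] := w0.
rewrite mxE (bigD1 a)//= ltr_pwDl ?sumr_ge0//.
  by rewrite [_^T _ _]mxE -expr2 exprn_even_gt0.
by move=> c _; rewrite [_^T _ _]mxE -expr2 sqr_ge0.
Qed.

(** Sum of the metrics [chart_metric] over a locally finite family of bumps: at each
    point one of them is positive definite, the others are nonnegative. *)
Lemma riemannian_metric : exists G : chart M -> M -> 'M[R]_n,
  [/\ forall i p, chart_dom i p -> posdef (G i p),
      forall i j p, chart_dom i p -> chart_dom j p ->
        G i p = jac i j p *m G j p *m (jac i j p)^T &
      forall i, smooth_mx (chart_image i) (fun x => G i (chart_inv i x))].
Proof.
have [I [posI finI]] := locally_finite_bumps M.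
pose supp p := fset_set [set b | I b /\ bfun b p != 0].
have fin p : finite_set [set b | I b /\ bfun b p != 0].
  have [N Np fN] := finI p; apply: sub_finite_set fN => b [Ib bp].
  by split => //; exists p => //; exact: nbhs_singleton.
have suppP p b : (b \in supp p) = `[< I b /\ bfun b p != 0 >].
  by rewrite in_fset_set// inE; apply/idP/asboolP; rewrite inE.
exists (fun i p => \sum_(b <- supp p) chart_metric i b p); split.
- move=> i p ip; split.
    rewrite linear_sum /=; apply: eq_bigr => b _.
    by rewrite /chart_metric linearZ /= trmx_mul trmxK.
  move=> v v0; have [b Ib bp] := posI p.
  have bs : b \in supp p by rewrite suppP; apply/asboolP; rewrite gt_eqF.
  rewrite mulmx_sumr mulmx_suml summxE (big_fsetD1 b)//=.
  rewrite ltr_pwDl ?chart_metric_form_gt0// sumr_ge0// => c _.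
  exact: chart_metric_form.
- move=> i j p ip jp; rewrite mulmx_sumr mulmx_suml.
  by apply: eq_bigr => b _; exact: chart_metric_congr.
- move=> i; apply: smooth_mx_local => x ix.
  have [N Nx fN] := finI (chart_inv i x).
  pose E := fset_set [set b | I b /\ exists2 q, N q & bfun b q != 0].
  pose U := (chart_image i `&` (chart_inv i @^-1` N))°.
  have oU : open U by exact: open_interior.
  have UiN y : U y -> chart_image i y /\ N (chart_inv i y) by exact: interior_subset.
  exists U; split => //; first exact: chart_inv_nbhs.
  have sS : smooth_mx U (fun y => \sum_(b <- E) chart_metric i b (chart_inv i y)).
    apply: smooth_mx_sum => // b.
    by apply: smooth_mx_subset (chart_metric_smooth i b) => y /UiN[].
  apply: (smooth_mx_eq oU _ sS) => y /UiN[iy Ny].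
  apply/esym/big_fset_incl => [|b bE].
    apply/fsubsetP => b; rewrite suppP => /asboolP[Ib bq].
    by rewrite in_fset_set//; apply/mem_set; split => //; exists (chart_inv i y).
  rewrite suppP => /asboolPn nb.
  rewrite /chart_metric (_ : bfun b _ = 0) ?scale0r//.
  apply/eqP; apply: contra_notT nb => bq; split => //.
  by move: bE; rewrite in_fset_set// => /set_mem[].
Qed.

End RiemannianMetric.

Theorem proposition4p12 (R : realType) (n : nat) (M : smoothManifold R n)
    (B : tensorField2 M) :
  (forall p : M, nondegenerate_tensor (B p)) ->
  constant_rank (fun p : M => skew_part (B p)) ->
  exists B' : tensorField2 M,
    [/\ (forall p : M, nondegenerate_tensor (B' p)),
        (forall p : M,
           directv (Ker (skew_part (B' p)) + Ker (sym_part (B' p))) /\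
           (Ker (skew_part (B' p)) + Ker (sym_part (B' p)))%VS = fullv) &
        (forall (p : M) (a b : cotangent p),
           Lambda2_inv (B p) (skew_part (B p)) a b =
           Lambda2_inv (B' p) (skew_part (B' p)) a b)].
Proof.
move=> ndB [r rB]; have [G [Gp Gcongr Gsmooth]] := @riemannian_metric R n M.
have uB i (p : M) : chart_dom i p -> tensor_mx i (B p) \in unitmx.
  by move=> ip; exact: nondegenerate_unit (ndB p).
pose ch (p : M) := projT1 (cid (chart_dom_cover p)).
have chP (p : M) : chart_dom (ch p) p by rewrite /ch; case: cid.
pose B' (p : M) : tensor2 p :=
  tensor_of_mx p (ch p) (adapted (tensor_mx (ch p) (B p)) (G (ch p) p)).
(* B' is defined in one chosen chart at each point; by covariance the same formula
   gives its matrix in every chart, hence its smoothness. *)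
have B'E i (p : M) : chart_dom i p ->
    tensor_mx i (B' p) = adapted (tensor_mx i (B p)) (G i p).
  move=> ip; rewrite (tensor_mx_congr _ ip (chP p)) tensor_of_mxK//.
  rewrite (tensor_mx_congr (B p) ip (chP p)) (Gcongr i (ch p))//.
  by rewrite adapted_congr//; [exact: uB|exact: Gp|exact: jac_unit].
have smoothB' : smooth_tensor2 B'.
  move=> i.
  have oI : open (chart_image i) by exact: chart_image_open.
  have sB : smooth_mx (chart_image i) (fun x => tensor_mx i (B (chart_inv i x))).
    move=> a b k; apply: (Ck_on_eq oI _ (tensor_at_smooth B i a b k)) => x _.
    by rewrite mxE.
  have sA := smooth_adapted (r := r) oI sB (Gsmooth i).
  have {}sA : smooth_mx (chart_image i)
      (fun x => adapted (tensor_mx i (B (chart_inv i x))) (G i (chart_inv i x))).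
    apply: sA => x /chart_inv_dom ix; [exact: uB|exact: Gp|].
    by rewrite -tensor_mx_skew tensor_rank_mx.
  move=> a b k; apply: (Ck_on_eq oI _ (sA a b k)) => x /chart_inv_dom ix.
  by rewrite -B'E// mxE.
have ndB' (p : M) : nondegenerate_tensor (B' p).
  apply: (unit_nondegenerate (chP p)); rewrite B'E//; apply: adapted_unit.
  exact: Gp.
exists (TensorField2 smoothB'); split => //= [p|p a b].
- split.
    apply/directv_addP/eqP; rewrite -subv0; apply/subvP => v.
    rewrite memv_cap !memv_ker memv0 => /andP[/eqP v1 /eqP v2].
    (* A vector in both kernels is in the kernel of B', the sum of its two parts. *)
    have : B' p v = 0.
      apply/lfunP => w.
      have := congr1 (fun f : cotangent p => f w) v1.
      have := congr1 (fun f : cotangent p => f w) v2.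
      rewrite /= skew_partE sym_partE zero_lfunE => v2w v1w.
      by rewrite [LHS](_ : _ = 0); [|lra].
    rewrite -[RHS](linear0 (B' p)) => /(bij_inj (ndB' p)) ->.
    exact: eqxx.
  apply/vspaceP => v; rewrite memvf; apply/memv_addP.
  pose i := ch p; have ip : chart_dom i p := chP p.
  have [k [d [vE k0 d0]]] :=
    adapted_splitting (tensor_mx i (B p)) (Gp i p ip) (component v i).
  exists (chart_vector i p k).
    rewrite memv_ker; apply/eqP/(tensor_eq0P _ _ ip).
    by rewrite chart_vectorK// tensor_mx_skew B'E.
  exists (chart_vector i p d).
    rewrite memv_ker; apply/eqP/(tensor_eq0P _ _ ip).
    by rewrite chart_vectorK// tensor_mx_sym B'E.
  rewrite -[LHS](componentK v ip) vE -[k in LHS]scale1r.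
  by rewrite (chart_vector_linear ip) scale1r.
- rewrite (Lambda2_inv_mx _ _ (chP p) (ndB p)) (Lambda2_inv_mx _ _ (chP p) (ndB' p)).
  by rewrite B'E// adapted_bivector//; exact: Gp.
Qed.
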